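(* Let $\mathcal U$ be a full rank upper cluster algebra (of geometric type) with initial seed $t_0$. Let $$M=\frac{P_M(A_{1;t_0},\ldots,A_{n;t_0})}{A_{1;t_0}^{d_1}\cdots A_{n;t_0}^{d_n}}$$ be a non-zero element of $\mathcal U$, where ${\bf d}_M:=(d_1,\ldots,d_n)^{\rm T}$ is the $d$-vector and $P_M$ the numerator polynomial of $M$ with respect to $A_{t_0}$. Then the following statements hold. (i) For any $k=1,\ldots,n$, $$d_k=(A_{k;t_0}\mid\mid M)_d=(A_{k;t_0}\mid\mid P_M)_v-(A_{k;t_0}\mid\mid M)_v.$$ (ii) If $(A_{k;t_0}\mid\mid M)_v=0$ for some $k$, that is, $M/A_{k;t_0}\notin\mathcal U$, then $d_k=(A_{k;t_0}\mid\mid M)_d=(A_{k;t_0}\mid\mid P_M)_v\geq 0$. (iii) If $(A_{k;t_0}\mid\mid M)_v=0$ for all $k=1,\ldots,n$, then ${\bf d}_M$ is uniquely determined by $P_M$ (that is, two non-zero elements of $\mathcal U$ satisfying this hypothesis and having the same numerator polynomial with respect to $A_{t_0}$ have the same $d$-vector).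
   Context: Throughout, $\mathbb K$ is a factorial domain (UFD) of characteristic $0$. A semifield $(\mathbb P,\oplus,\cdot)$ is an abelian multiplicative group with a commutative, associative operation $\oplus$ over which multiplication distributes; $\mathbb{KP}$ is its group ring over $\mathbb K$, and $\mathcal F$ is the field of rational functions in $n$ independent variables with coefficients in $\mathbb{KP}$. An integer $n\times n$ matrix $B$ is skew-symmetrizable if $SB$ is skew-symmetric for some integer diagonal matrix $S$ with positive diagonal entries. A (labeled) $\mathscr A$-seed over $\mathbb P$ is a triple $(B,X,A)$ with $B=(b_{ij})$ an $n\times n$ skew-symmetrizable integer matrix, $X=(X_1,\ldots,X_n)\in\mathbb P^n$, and $A=(A_1,\ldots,A_n)$ a free generating set of $\mathcal F$ over $\mathbb{KP}$. Its $k$-th exchange binomial is $P_k=\frac{X_k}{1\oplus X_k}\prod_{b_{jk}>0}A_j^{b_{jk}}+\frac{1}{1\oplus X_k}\prod_{b_{jk}<0}A_j^{-b_{jk}}$. The mutation $\mu_k(B,X,A)=(B',X',A')$ is: $b'_{ij}=-b_{ij}$ if $i=k$ or $j=k$, else $b'_{ij}=b_{ij}+\mathrm{sgn}(b_{ik})\max(b_{ik}b_{kj},0)$; $X'_k=X_k^{-1}$ and $X'_i=X_iX_k^{\max(b_{ki},0)}(1\oplus X_k)^{-b_{ki}}$ for $i\ne k$; $A'_i=A_i$ for $i\neq k$ and $A'_k=A_k^{-1}P_k$. Let $\mathbb T_n$ be the $n$-regular tree with edges labeled $1,\ldots,n$ so that edges at each vertex have distinct labels. An $\mathscr A$-seed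 pattern assigns to each vertex $t$ a seed $(B_t,X_t,A_t)$, $B_t=(b^t_{ij})$, $X_t=(X_{1;t},\ldots,X_{n;t})$, $A_t=(A_{1;t},\ldots,A_{n;t})$, such that seeds at vertices joined by an edge labeled $k$ are related by $\mu_k$. A vertex and its seed are denoted by the same letter; one vertex $t_0$ is chosen as initial. The upper cluster algebra is $\mathcal U=\bigcap_{t}\mathcal L(t)$ with $\mathcal L(t)=\mathbb{KP}[A_{1;t}^{\pm1},\ldots,A_{n;t}^{\pm1}]$. The $A_{k;t}$ are the cluster variables (they lie in $\mathcal U$), $A_t$ is the cluster at $t$. Standing assumption: no exchange binomial of $\mathcal U$ is invertible in $\mathbb{KP}$. Geometric type: $\mathbb P=\mathrm{Trop}(Z_1,\ldots,Z_m)$, the free abelian group on $Z_1,\ldots,Z_m$ with $\prod Z_i^{a_i}\oplus\prod Z_i^{b_i}=\prod Z_i^{\min(a_i,b_i)}$. Writing $X_{k;t}=\prod_i Z_i^{c_{ik}^t}$, $C_t=(c_{ij}^t)_{m\times n}$, the extended exchange matrix is the $(n+m)\times n$ matrix $\widetilde B_t=\begin{pmatrix}B_t\\C_t\end{pmatrix}$. $\mathcal U$ is full rank if it is of geometric type and $\widetilde B_{t_0}$ has full rank $n$ (then every $\widetilde B_t$ has). Valuation pairing: for a cluster variable $A_{k;t}$ and $M\in\mathcal U$, $(A_{k;t}\mid\mid M)_v:=\max\{s\in\mathbb N\mid M/A_{k;t}^s\in\mathcal U\}\in\mathbb N\cup\{\infty\}$. $d$-vector: any non-zero $M\in\mathcal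 L(t_0)$ is uniquely $M=P_M(A_{1;t_0},\ldots,A_{n;t_0})/(A_{1;t_0}^{d_1}\cdots A_{n;t_0}^{d_n})$ with $d_i\in\mathbb Z$ and $P_M\in\mathbb{KP}[A_{1;t_0},\ldots,A_{n;t_0}]$ not divisible by any $A_{j;t_0}$; $(d_1,\ldots,d_n)^{\rm T}$ is the $d$-vector and $P_M$ the numerator polynomial of $M$ with respect to $A_{t_0}$. For $0\ne M\in\mathcal U$, the $d$-compatibility degree $(A_{k;t_0}\mid\mid M)_d$ is the $k$-th component of the $d$-vector of $M$ with respect to $A_{t_0}$ (known to depend only on the cluster variable $A_{k;t_0}$ and on $M$, not on the seed containing $A_{k;t_0}$). *)

(* Defs.v *)
From HB Require Import structures.
From mathcomp Require Import all_boot all_order all_algebra.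
From mathcomp Require Import finmap.
From mathcomp Require monalg.
From mathcomp Require Import boolp.

Set Implicit Arguments.
Unset Strict Implicit.
Unset Printing Implicit Defensive.

Import Order.TTheory GRing.Theory Num.Theory.
Local Open Scope ring_scope.

(* The multiplication that [monalg] puts on [{malg K[G]}] requires the monoid
   [G] to have no units but 1, which excludes groups.  We keep its free
   [K]-module on [G] and equip it with the convolution product, for an abelian
   group [G] in additive notation. *)
Module Export GroupRing.
Import monalg.
Local Open Scope fset_scope.
Local Open Scope ring_scope.

Definition groupring (K : nzRingType) (G : zmodType) : Type := {malg K[G]}.

HB.instance Definition _ (K : nzRingType) (G : zmodType) :=
  GRing.Zmodule.copy (groupring K G) {malg K[G]}.

Definition grmon (K : nzRingType) (G : zmodType) (x : G) : groupring K G :=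
  << 1 *g x >>.

Section Ring.
Variables (K : nzRingType) (G : zmodType).
Implicit Types g : {malg K[G]}.

Local Notation "g1 *M_[ x , y ] g2" := << g1@_x * g2@_y *g x + y >>
  (at level 40, no associativity).

Definition grmul g1 g2 : {malg K[G]} :=
  \sum_(x <- msupp g1) \sum_(y <- msupp g2) g1 *M_[x, y] g2.

Lemma grmulr g1 g2 :
  grmul g1 g2 = \sum_(y <- msupp g2) \sum_(x <- msupp g1) g1 *M_[x, y] g2.
Proof. by rewrite /grmul exchange_big. Qed.

Lemma grmulw (d1 d2 : {fset G}) g1 g2 :
  msupp g1 `<=` d1 -> msupp g2 `<=` d2 ->
  grmul g1 g2 = \sum_(x <- d1) \sum_(y <- d2) g1 *M_[x, y] g2.
Proof.
move=> le_d1 le_d2; rewrite /grmul (big_fset_incl _ le_d1) /=.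
  apply/eq_bigr=> k1 _; apply/big_fset_incl => // k _ /mcoeff_outdom ->.
  by rewrite mulr0 monalgU0.
move=> k _ /mcoeff_outdom g1k.
by rewrite big1 => // k' _; rewrite g1k mul0r monalgU0.
Qed.

Lemma grmulUg c x g :
  grmul << c *g x >> g = \sum_(y <- msupp g) << c * g@_y *g x + y >>.
Proof.
rewrite (grmulw msuppU_le (fsubset_refl _)) big_seq_fset1.
by apply/eq_bigr => y _; rewrite mcoeffUU.
Qed.

Lemma grmulgU c x g :
  grmul g << c *g x >> = \sum_(y <- msupp g) << g@_y * c *g y + x >>.
Proof.
rewrite (grmulw (fsubset_refl _) msuppU_le); apply/eq_bigr => y _.
by rewrite big_seq_fset1 mcoeffUU.
Qed.

Lemma grmulUU c1 c2 x y :
  grmul << c1 *g x >> << c2 *g y >> = << c1 * c2 *g x + y >>.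
Proof. by rewrite (grmulw msuppU_le msuppU_le) !big_seq_fset1 !mcoeffUU. Qed.

Lemma grmul0g : left_zero 0 grmul.
Proof. by move=> g; rewrite /grmul msupp0 big_seq_fset0. Qed.

Lemma grmulg0 : right_zero 0 grmul.
Proof. by move=> g; rewrite grmulr msupp0 big_seq_fset0. Qed.

Lemma grmul1g : left_id << 1 *g 0 >> grmul.
Proof.
move=> g; rewrite grmulUg [RHS]monalgE.
by apply/eq_bigr => y _; rewrite mul1r add0r.
Qed.

Lemma grmulg1 : right_id << 1 *g 0 >> grmul.
Proof.
move=> g; rewrite grmulgU [RHS]monalgE.
by apply/eq_bigr => y _; rewrite mulr1 addr0.
Qed.

Lemma grmulDl : left_distributive grmul +%R.
Proof.
move=> g1 g2 g.
rewrite [in RHS](grmulw (fsubsetUl (msupp g1) (msupp g2)) (fsubset_refl _)).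
rewrite [in RHS](grmulw (fsubsetUr (msupp g1) (msupp g2)) (fsubset_refl _)).
rewrite (grmulw (msuppD_le _ _) (fsubset_refl _)).
rewrite -big_split /=; apply/eq_bigr=> x _.
rewrite -big_split /=; apply/eq_bigr=> y _.
by rewrite mcoeffD mulrDl monalgUD.
Qed.

Lemma grmulDr : right_distributive grmul +%R.
Proof.
move=> g g1 g2.
rewrite [in RHS](grmulw (fsubset_refl _) (fsubsetUl (msupp g1) (msupp g2))).
rewrite [in RHS](grmulw (fsubset_refl _) (fsubsetUr (msupp g1) (msupp g2))).
rewrite (grmulw (fsubset_refl _) (msuppD_le _ _)).
rewrite -big_split /=; apply/eq_bigr=> x _.
rewrite -big_split /=; apply/eq_bigr=> y _.
by rewrite mcoeffD mulrDr monalgUD.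
Qed.

Lemma grmulEl g1 g2 :
  grmul g1 g2 = \sum_(x <- msupp g1) grmul << g1@_x *g x >> g2.
Proof. by apply/eq_bigr => x _; rewrite grmulUg. Qed.

Lemma grmulEr g1 g2 :
  grmul g1 g2 = \sum_(y <- msupp g2) grmul g1 << g2@_y *g y >>.
Proof. by rewrite grmulr; apply/eq_bigr => y _; rewrite grmulgU. Qed.

Lemma grmulA : associative grmul.
Proof.
move=> g1 g2 g3.
rewrite [RHS](big_morph (grmul^~ _) (fun _ _ => grmulDl _ _ _) (grmul0g _)).
rewrite grmulEl; apply/eq_bigr=> x _.
rewrite [LHS](big_morph (grmul _) (fun _ _ => grmulDr _ _ _) (grmulg0 _)).
rewrite [RHS](big_morph (grmul^~ _) (fun _ _ => grmulDl _ _ _) (grmul0g _)).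
apply/eq_bigr=> y _.
rewrite [LHS](big_morph (grmul _) (fun _ _ => grmulDr _ _ _) (grmulg0 _)).
by rewrite grmulEr; apply/eq_bigr=> z _; rewrite !grmulUU mulrA addrA.
Qed.

Lemma grone_neq0 : << 1 *g 0 >> != 0 :> {malg K[G]}.
Proof. by rewrite monalgU_eq0 oner_eq0. Qed.

Lemma mcoeff_grmul g1 g2 z : (grmul g1 g2)@_z =
  \sum_(x <- msupp g1) \sum_(y <- msupp g2) (g1@_x * g2@_y) *+ (x + y == z).
Proof.
rewrite /grmul raddf_sum; apply: eq_bigr => x _.
by rewrite raddf_sum; apply: eq_bigr => y _; rewrite /= mcoeffU.
Qed.

HB.instance Definition _ := GRing.Zmodule_isNzRing.Build (groupring K G)
  grmulA grmul1g grmulg1 grmulDl grmulDr grone_neq0.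

Lemma grmonD (x y : G) : grmon K (x + y) = grmon K x * grmon K y.
Proof. by rewrite /grmon [RHS]grmulUU mulr1. Qed.

Lemma grmon0 : grmon K 0 = 1 :> groupring K G.
Proof. by []. Qed.

End Ring.

Lemma grmulC (K : comNzRingType) (G : zmodType) : commutative (@grmul K G).
Proof.
move=> g1 g2; rewrite grmulr; apply/eq_bigr => x _; apply/eq_bigr => y _.
by rewrite mulrC addrC.
Qed.

HB.instance Definition _ (K : comNzRingType) (G : zmodType) :=
  GRing.PzRing_hasCommutativeMul.Build (groupring K G) (@grmulC K G).

Section Unit.
Variables (K : comNzRingType) (G : zmodType).
Implicit Types g : groupring K G.

Definition grunit : {pred groupring K G} := fun g => `[< exists h, h * g = 1 >].

Definition grinv g : groupring K G :=
  if pselect (exists h, h * g = 1) is left e then sval (cid e) else g.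

Lemma grmulV : {in grunit, left_inverse 1 grinv *%R}.
Proof.
move=> g /asboolP gU; rewrite /grinv; case: pselect => // e.
by case: cid.
Qed.

Lemma grunitPl g h : h * g = 1 -> grunit g.
Proof. by move=> e; apply/asboolP; exists h. Qed.

Lemma grinv_out : {in [predC grunit], grinv =1 id}.
Proof. by move=> g /asboolP gU; rewrite /grinv; case: pselect. Qed.

HB.instance Definition _ := GRing.ComNzRing_hasMulInverse.Build (groupring K G)
  grmulV grunitPl grinv_out.

End Unit.

Section Domain.
Variables (K : idomainType) (m : nat).
Local Notation G := 'rV[int]_m.

Let pos (w : G) :=
  exists i : 'I_m, (forall j : 'I_m, (j < i)%N -> w 0 j = 0) /\ 0 < w 0 i.

Let posD v w : pos v -> pos w -> pos (v + w).
Proof.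
move=> [i [vi0 vi]] [j [wj0 wj]]; case: (ltngtP i j) => [ij|ji|/val_inj eij].
- exists i; rewrite mxE wj0 // addr0; split=> // k ki.
  by rewrite mxE vi0 // wj0 ?addr0 // (ltn_trans ki).
- exists j; rewrite mxE vi0 // add0r; split=> // k kj.
  by rewrite mxE wj0 // vi0 ?addr0 // (ltn_trans kj).
- subst j; exists i; rewrite mxE addr_gt0 //; split=> // k ki.
  by rewrite mxE vi0 // wj0 ?addr0.
Qed.

Let pos0 : ~ pos 0.
Proof. by move=> [i [_]]; rewrite mxE ltxx. Qed.

Let pos_total w : w != 0 -> pos w \/ pos (- w).
Proof.
case/rV0Pn => i0 wi0.
case: (@arg_minnP _ i0 (fun i => w 0 i != 0) (@nat_of_ord m) wi0) => i wi imin.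
have w0 (j : 'I_m) : (j < i)%N -> w 0 j = 0.
  by move=> ji; apply/eqP/negPn/negP => /imin; rewrite leqNgt ji.
case: (ltrgtP (w 0 i) 0) => [lt|gt|eq]; last by rewrite eq eqxx in wi.
- right; exists i; rewrite mxE oppr_gt0; split=> // j ji.
  by rewrite mxE w0 ?oppr0.
- by left; exists i.
Qed.

Let max_seq (s : seq G) : s != [::] ->
  exists2 x : G, x \in s & forall y : G, y \in s -> y != x -> pos (x - y).
Proof.
elim: s => // a s IHs _; have [->|/IHs[x xs xmax]] := eqVneq s [::].
  by exists a; rewrite ?mem_head // => y /[!inE] ->.
have [eax|nax] := eqVneq a x.
  exists x; rewrite ?inE ?xs ?orbT // => y /[!inE] /predU1P[->|]; last exact: xmax.
  by rewrite eax eqxx.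
have /pos_total[pax|pxa] : a - x != 0 by rewrite subr_eq0.
- exists a; rewrite ?mem_head // => y /[!inE] /predU1P[->|ys ya].
    by rewrite eqxx.
  have [-> //|yx] := eqVneq y x.
  by rewrite -(subrK x a) -addrA; apply: posD pax _; apply: xmax.
- exists x; rewrite ?inE ?xs ?orbT // => y /[!inE] /predU1P[-> _|]; last exact: xmax.
  by rewrite -opprB.
Qed.

Lemma groupring_integral (f g : groupring K G) :
  f * g = 0 -> (f == 0) || (g == 0).
Proof.
move=> fg0; apply/negPn/negP; rewrite negb_or => /andP[f0 g0].
have supp0 (h : groupring K G) : h != 0 -> (msupp h : seq G) != [::].
  apply: contra => /eqP e; apply/eqP/malgP => k.
  by rewrite mcoeff0 mcoeff_outdom //; change (k \notin (msupp h : seq G)); rewrite e.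
have [x xf xmax] := max_seq (supp0 _ f0).
have [y yg ymax] := max_seq (supp0 _ g0).
have : (grmul f g)@_(x + y) = 0 by rewrite [grmul f g]fg0 mcoeff0.
rewrite mcoeff_grmul (big_fsetD1 x) //= (big_fsetD1 y) //= eqxx mulr1n.
rewrite -addrA [X in _ + X](_ : _ = 0) ?addr0; last first.
  rewrite big1_seq ?add0r ?big1_seq //.
  - move=> x' /andP[_]; rewrite !inE => /andP[x'x x'f].
    rewrite big1_seq // => y' /andP[_ y'g].
    case: eqP => [exy|_]; last by rewrite mulr0n.
    case: pos0; have e : x - x' = - (y - y').
      apply/eqP; rewrite opprB subr_eq addrAC eq_sym subr_eq addrC exy //.
    have y'y : y' != y.
      by apply: contra_neq x'x => eyy; move: e; rewrite eyy subrr oppr0 => /subr0_eq.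
    rewrite -(subrr (y - y')) addrC -e.
    by apply: posD; [apply: xmax | apply: ymax].
  - move=> y' /andP[_]; rewrite !inE => /andP[y'y _].
    by rewrite (inj_eq (addrI x)) (negPf y'y) mulr0n.
by move/eqP; rewrite mulf_eq0 !mcoeff_eq0 xf yg.
Qed.

HB.instance Definition _ :=
  GRing.ComUnitRing_isIntegral.Build (groupring K G) groupring_integral.

End Domain.

End GroupRing.

From mathcomp Require Import mpoly.

Definition irreducible_elt (R : idomainType) (p : R) : Prop :=
  [/\ p != 0, p \isn't a GRing.unit
    & forall a b, p = a * b -> a \is a GRing.unit \/ b \is a GRing.unit].

Definition associated (R : idomainType) (a b : R) : Prop :=
  exists2 u, u \is a GRing.unit & b = u * a.

Definition factorial_domain (R : idomainType) : Prop :=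
  (forall x : R, x != 0 -> exists u, exists s : seq R,
     [/\ u \is a GRing.unit, {in s, forall p, irreducible_elt p}
       & x = u * \prod_(p <- s) p])
  /\ (forall s1 s2 : seq R,
       {in s1, forall p, irreducible_elt p} ->
       {in s2, forall p, irreducible_elt p} ->
       associated (\prod_(p <- s1) p) (\prod_(p <- s2) p) ->
       exists s3, [/\ perm_eq s2 s3, size s1 = size s3
         & forall i, (i < size s1)%N -> associated s1`_i s3`_i]).

(* [Trop(Z_1, ..., Z_m)]: the row [x] stands for the monomial
   [\prod_i Z_i ^ (x 0 i)], so the product, the unit, the inverse and the [z]-th
   power of the semifield are [x + y], [0], [- x] and [x *~ z]. *)
Definition trop (m : nat) : zmodType := 'rV[int]_m.

Definition oplus (m : nat) (x y : trop m) : trop m :=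
  \row_i Num.min (x 0 i) (y 0 i).

Section Cluster.
Variables (K : idomainType) (n m : nat).

Definition KP : idomainType := groupring K 'rV[int]_m.

Definition ambient : fieldType := {fraction {mpoly KP[n]}}.

Definition ambientC : KP -> ambient := @tofrac {mpoly KP[n]} \o @mpolyC n KP.
HB.instance Definition _ := GRing.RMorphism.on ambientC.

Definition tropF (x : trop m) : ambient := ambientC (grmon K x).

Record seed : Type := Seed {
  exch : 'M[int]_n;
  coef : {ffun 'I_n -> trop m};
  clus : {ffun 'I_n -> ambient}
}.

Definition skew_symmetrizable (B : 'M[int]_n) : Prop :=
  exists s : 'rV[int]_n, (forall i, 0 < s 0 i) /\
    (diag_mx s *m B)^T = - (diag_mx s *m B).

Definition eval_at (A : {ffun 'I_n -> ambient}) (p : {mpoly KP[n]}) : ambient :=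
  mmap ambientC A p.

Definition free_generating (A : {ffun 'I_n -> ambient}) : Prop :=
  injective (eval_at A) /\
  forall f : ambient, exists p q,
    eval_at A q != 0 /\ f = eval_at A p / eval_at A q.

Definition is_seed (S : seed) : Prop :=
  skew_symmetrizable (exch S) /\ free_generating (clus S).

Definition exchange_binomial (S : seed) (k : 'I_n) : ambient :=
  tropF (coef S k - oplus 0 (coef S k))
    * \prod_(j | 0 < exch S j k) clus S j ^ exch S j k
  + tropF (- oplus 0 (coef S k))
    * \prod_(j | exch S j k < 0) clus S j ^ (- exch S j k).

Definition mutation (k : 'I_n) (S : seed) : seed :=
  let: Seed B X A := S in
  Seed
    (\matrix_(i, j)
       if (i == k) || (j == k) then - B i j
       else B i j + Num.sg (B i k) * Num.max (B i k * B k j) 0)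
    [ffun i =>
       if i == k then - X k
       else X i + X k *~ Num.max (B k i) 0 - oplus 0 (X k) *~ B k i]
    [ffun i => if i == k then (A k)^-1 * exchange_binomial S k else A i].

(* Vertices of the [n]-regular tree: words without two equal consecutive
   letters.  Two vertices are joined by the edge labelled [k] when one is
   obtained from the other by prepending [k]. *)
Definition tree : Type :=
  {w : seq 'I_n | sorted (fun i j => i != j) w}.

Definition tree_edge (k : 'I_n) (t t' : tree) : Prop :=
  val t' = k :: val t \/ val t = k :: val t'.

Definition seed_pattern (S : tree -> seed) : Prop :=
  (forall t, is_seed (S t)) /\
  (forall k t t', tree_edge k t t' -> S t' = mutation k (S t)).

Definition coef_matrix (S : seed) : 'M[int]_(m, n) :=
  \matrix_(i, j) (coef S j : 'rV[int]_m) 0 i.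

Definition extended_exchange_matrix (S : seed) : 'M[int]_(n + m, n) :=
  col_mx (exch S) (coef_matrix S).

Definition full_rank (S : seed) : Prop :=
  \rank (map_mx (intr : int -> rat) (extended_exchange_matrix S)) = n.

Definition monomial_at (A : {ffun 'I_n -> ambient}) (d : 'cV[int]_n) : ambient :=
  \prod_i A i ^ d i 0.

Definition laurent_ring (S : seed) (f : ambient) : Prop :=
  exists p d, f = eval_at (clus S) p / monomial_at (clus S) d.

Definition upper_cluster_algebra (S : tree -> seed) (f : ambient) : Prop :=
  forall t, laurent_ring (S t) f.

Definition invertible_in_KP (f : ambient) : Prop :=
  exists2 c : KP, c \is a GRing.unit & f = ambientC c.

Definition noninvertible_binomials (S : tree -> seed) : Prop :=
  forall t k, ~ invertible_in_KP (exchange_binomial (S t) k).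

Definition is_valuation (S : tree -> seed) (a M : ambient) (s : nat) : Prop :=
  upper_cluster_algebra S (M / a ^+ s) /\
  forall r, upper_cluster_algebra S (M / a ^+ r) -> (r <= s)%N.

(* [(a || M)_v] for [M] in the upper cluster algebra; [None] stands for
   infinity. *)
Definition valuation_pairing (S : tree -> seed) (a M : ambient) : option nat :=
  if pselect (exists s, is_valuation S a M s) is left e
  then Some (sval (cid e)) else None.

(* [d] is the d-vector and [P] the numerator polynomial of [M] with respect to
   the cluster of [S]. *)
Definition d_presentation (S : seed) (M : ambient)
    (d : 'cV[int]_n) (P : {mpoly KP[n]}) : Prop :=
  (forall j, ~ exists Q : {mpoly KP[n]}, P = 'X_j * Q) /\
  M = eval_at (clus S) P / monomial_at (clus S) d.

(* The default value is irrelevant: a non-zero Laurent polynomial has a unique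
   d-vector. *)
Definition d_vector (S : seed) (M : ambient) : 'cV[int]_n :=
  if pselect (exists d, exists P, d_presentation S M d P) is left e
  then sval (cid e) else 0.

(* [(A_k || M)_d] for the [k]-th cluster variable of [S]. *)
Definition d_compatibility (S : seed) (k : 'I_n) (M : ambient) : int :=
  d_vector S M k 0.

End Cluster.

(* Main.v *)
(** Let U0(t) be the set of [f] that are Laurent in the cluster at [t] and in all
    clusters adjacent to [t].  In the full rank case the upper cluster algebra
    equals U0(t) for every [t], because U0 does not change under the mutation at
    [l].  To see this, fix another direction [k], put [y := A_k] and let [y'],
    [y''] be its mutations before and after mutating at [l]; let [T] be generated
    by the Laurent monomials free of [y] in the mutated cluster.  Elements that
    are Laurent in two adjacent clusters are generated by monomials free of the
    exchanged variable together with both exchanged variables.  As [y'] lies in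
    [T[y, y'']], such an [f] satisfies [P_l^s f \in T[y, y'']] for some [s], while
    [y^t f \in T[y]] for some [t].  If [b_kl <> 0], then [P_l] and [y] generate the
    unit ideal of [T[y, y'']].  If [b_kl = 0], then [P_l] and [P_k] are free of [y]
    and [P_l] is not a zero divisor modulo powers of [P_k], because columns [k] and
    [l] of the extended exchange matrix are linearly independent.  In both cases
    [f \in T[y, y'']].

    Consequently [M / A_k^s] is in the upper cluster algebra as soon as it is
    Laurent in the cluster adjacent to [t0] along [k], where the [A_j], [j <> k],
    are units; so replacing [M] by [P_M = M * \prod_j A_j^(d_j)] shifts the
    valuation at [A_k] by [d_k].  The valuation is finite since dividing by the
    non-monomial [P_k] shrinks the range of exponents. *)

Require Import Defs.
From HB Require Import structures.
From mathcomp Require Import all_boot all_order all_algebra.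
From mathcomp Require Import mpoly.
From mathcomp Require finmap monalg.
From mathcomp Require Import boolp.
From mathcomp Require Import zify ring.

Set Implicit Arguments.
Unset Strict Implicit.
Unset Printing Implicit Defensive.

Import Order.TTheory GRing.Theory Num.Theory.
Local Open Scope ring_scope.

(** * Gradings of the group ring and divisibility by binomials *)

Module Export GroupRingTheory.
Import finmap monalg.
Local Open Scope fset_scope.
Local Open Scope ring_scope.

Section Coefficients.
Variables (K : comNzRingType) (G : zmodType).
Implicit Types (f h : groupring K G) (g u : G) (D : pred G).

Definition grcoef g h : K := mcoeff g h.

Lemma grcoefP f h : (forall g, grcoef g f = grcoef g h) -> f = h.
Proof. by move=> e; apply/malgP. Qed.

Lemma grcoef0 g : grcoef g 0 = 0.
Proof. exact: mcoeff0. Qed.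

Lemma grcoefD g f h : grcoef g (f + h) = grcoef g f + grcoef g h.
Proof. exact: mcoeffD. Qed.

Lemma grcoef_mon g u : grcoef g (grmon K u) = (u == g)%:R.
Proof. exact: mcoeffU. Qed.

Lemma grcoef_monM g u h : grcoef g (grmon K u * h) = grcoef (g - u) h.
Proof.
rewrite /grcoef /GRing.mul /= grmulUg raddf_sum /=.
under eq_bigr => y _ do
  rewrite mcoeffU mul1r -[_ == g](inj_eq (addIr (- u))) addrAC subrr add0r.
have [hg|hg] := boolP (g - u \in msupp h).
  rewrite (big_fsetD1 _ hg) /= eqxx mulr1n big1_seq ?addr0 // => y /=.
  by rewrite !inE => /andP[/negPf-> _]; rewrite mulr0n.
rewrite big1_seq ?mcoeff_outdom // => y /= yh.
by case: eqP => [e|_]; [rewrite -e yh in hg | rewrite mulr0n].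
Qed.

Definition grpart D h : groupring K G :=
  \sum_(g <- msupp h | D g) (<< mcoeff g h *g g >> : {malg K[G]}).

Lemma grcoef_part D g h : grcoef g (grpart D h) = if D g then grcoef g h else 0.
Proof.
rewrite /grcoef /grpart raddf_sum /=.
under eq_bigr => y _ do rewrite mcoeffU.
have [hg|hg] := boolP (g \in msupp h); last first.
  rewrite (mcoeff_outdom hg) if_same big1_seq // => y /andP[_ yh].
  by case: eqP => [e|_]; [rewrite -e yh in hg | rewrite mulr0n].
rewrite big_mkcond (big_fsetD1 _ hg) /= eqxx mulr1n big1_seq ?addr0 // => y /=.
by rewrite !inE => /andP[/negPf-> _]; rewrite mulr0n if_same.
Qed.

Lemma grpartD D f h : grpart D (f + h) = grpart D f + grpart D h.
Proof.
apply: grcoefP => g; rewrite grcoefD !grcoef_part grcoefD.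
by case: ifP => // _; rewrite addr0.
Qed.

Lemma grpart_id D h : grpart D (grpart D h) = grpart D h.
Proof. by apply: grcoefP => g; rewrite !grcoef_part; case: (D g). Qed.

Lemma grpart_predC D h : grpart D h + grpart (predC D) h = h.
Proof.
apply: grcoefP => g; rewrite grcoefD !grcoef_part /=.
by case: (D g); rewrite ?addr0 ?add0r.
Qed.

Lemma grpart_sub D D' h : (forall g, D g -> D' g) ->
  grpart D (grpart D' h) = grpart D h.
Proof.
move=> sDD'; apply: grcoefP => g; rewrite !grcoef_part.
by case: ifP => // /sDD'->.
Qed.

Lemma grpart_disj D h : grpart D (grpart (predC D) h) = 0.
Proof.
by apply: grcoefP => g; rewrite !grcoef_part grcoef0 /=; case: (D g).
Qed.

Lemma grpart_monM D u h : (forall g, D (g + u) = D g) ->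
  grpart D (grmon K u * h) = grmon K u * grpart D h.
Proof.
move=> Du; apply: grcoefP => g.
by rewrite grcoef_part !grcoef_monM grcoef_part -[in RHS]Du subrK.
Qed.

Lemma grpart_binomXM D u v s h :
  (forall g, D (g + u) = D g) -> (forall g, D (g + v) = D g) ->
  grpart D ((grmon K u + grmon K v) ^+ s * h)
    = (grmon K u + grmon K v) ^+ s * grpart D h.
Proof.
move=> Du Dv; elim: s h => [|s IHs] h; first by rewrite !expr0 !mul1r.
rewrite exprSr -!mulrA IHs; congr (_ * _).
by rewrite !mulrDl grpartD !grpart_monM.
Qed.

Variable lam : {additive G -> int}.

Lemma grcoef_bounded h :
  exists M : nat, forall g, grcoef g h != 0 -> `|lam g| <= M%:Z.
Proof.
exists (\sum_(g <- msupp h) `|lam g|%N)%N => g.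
rewrite /grcoef mcoeff_neq0 => gh.
by rewrite -abszE lez_nat (big_fsetD1 _ gh) /= leq_addr.
Qed.

(** Since [X^u c = - c + f], multiplication by [X^u] negates [c] modulo [f]. *)
Lemma grmon_alternate u c f s : (grmon K u + 1) * c = f ->
  exists h, grmon K u ^+ s * c = (-1) ^+ s * c + f * h.
Proof.
move=> e; elim: s => [|s [h IHs]]; first by exists 0; rewrite mulr0 addr0 !expr0.
exists ((-1) ^+ s + grmon K u * h).
rewrite exprS -mulrA IHs !mulrDr -e exprS; ring.
Qed.

Lemma grmonX u s : grmon K u ^+ s = grmon K (u *+ s).
Proof.
elim: s => [|s IHs]; first by rewrite expr0 mulr0n grmon0.
by rewrite exprS mulrS grmonD IHs.
Qed.

(* Modulo [X^v + 1] we have [c = +-X^(s u) c] for all [s]; for large [s] the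
   two sides live in disjoint ranges of [lam], which [X^v + 1] respects. *)
Lemma binom1_coprime u v c h : lam v = 0 -> lam u != 0 ->
  (grmon K u + 1) * c = (grmon K v + 1) * h ->
  exists e, c = (grmon K v + 1) * e.
Proof.
move=> lv lu e; have [M Mc] := grcoef_bounded c.
(* Shifting by [2M+1] times [u] carries the range [|lam| <= M] off itself, because [|lam u| >= 1];
   the exponent is odd, so the sign is [-1]. *)
have [h' e'] := grmon_alternate (M.*2.+1) e.
pose D g := `|lam g| <= M%:Z.
have Dv g : D (g + v) = D g by rewrite /D raddfD /= lv addr0.
have D0 g : D (g + 0) = D g by rewrite addr0.
exists (grpart D (h * h')).
have partc : grpart D c = c.
  apply: grcoefP => g; rewrite grcoef_part; case: ifP => // Dg.
  by apply/eqP; rewrite eq_sym; apply: contraFT Dg => /Mc.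
have partuc : grpart D (grmon K u ^+ (M.*2.+1) * c) = 0.
  apply: grcoefP => g; rewrite grcoef_part grcoef0; case: ifP => // Dg.
  rewrite grmonX grcoef_monM; apply/eqP; apply: contraTT Dg => /Mc.
  rewrite raddfB raddfMn /= /D -mulr_natr natz; move: (lam g) (lam u) lu => x y; nia.
have /= := congr1 (grpart D) e'.
rewrite partuc -signr_odd /= odd_double expr1 mulN1r grpartD -mulrA.
rewrite -[grmon K v + 1]/(grmon K v + grmon K 0) -[X in X * (h * h')]expr1.
rewrite grpart_binomXM // expr1 -mulN1r -[-1]expr1 => /eqP.
have -> : grpart D ((-1) ^+ 1 * c) = - c.
  rewrite expr1 mulN1r; apply: grcoefP => g.
  rewrite grcoef_part -[- c]mulN1r.
  by move: (congr1 (fun f => grcoef g (f : groupring K G)) partc);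
     rewrite grcoef_part /grcoef mulN1r mcoeffN; case: ifP => // _ <-; rewrite oppr0.
by rewrite eq_sym addrC subr_eq0 => /eqP->.
Qed.

(** Each binomial is a monomial, hence a unit, times some [X^w + 1]. *)
Lemma binom_coprime u1 u2 v1 v2 c h : lam v1 = lam v2 -> lam u1 != lam u2 ->
  (grmon K u1 + grmon K u2) * c = (grmon K v1 + grmon K v2) * h ->
  exists e, c = (grmon K v1 + grmon K v2) * e.
Proof.
have binomE (x y : G) : grmon K x + grmon K y = grmon K y * (grmon K (x - y) + 1).
  by rewrite mulrDr mulr1 -grmonD [y + _]addrC subrK.
have monK (x : G) : grmon K x * grmon K (- x) = 1 by rewrite -grmonD subrr grmon0.
move=> lv lu; rewrite (binomE u1) (binomE v1) => e.
have lv' : lam (v1 - v2) = 0 by rewrite raddfB /= lv subrr.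
have lu' : lam (u1 - u2) != 0 by rewrite raddfB subr_eq0.
have [|e' ->] := @binom1_coprime (u1 - u2) _ c (grmon K (v2 - u2) * h) lv' lu'.
  have := congr1 (GRing.mul (grmon K (- u2))) e.
  rewrite !mulrA [_ * grmon K u2]mulrC monK mul1r => ->.
  by rewrite -grmonD addrC [X in X * h]mulrC.
by exists (grmon K (- v2) * e'); rewrite -[LHS]mul1r -(monK v2); ring.
Qed.

(** Stripping the [u]-binomials one at a time shows that one [v]-binomial divides [c]; regularity
    cancels it, which gives the induction on [j]. *)
Lemma binomX_coprime u1 u2 v1 v2 s j c h : lam v1 = lam v2 -> lam u1 != lam u2 ->
  GRing.lreg (grmon K v1 + grmon K v2) ->
  (grmon K u1 + grmon K u2) ^+ s * c = (grmon K v1 + grmon K v2) ^+ j * h ->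
  exists e, c = (grmon K v1 + grmon K v2) ^+ j * e.
Proof.
move=> lv lu reg.
have dvd x y : (grmon K u1 + grmon K u2) ^+ s * x = (grmon K v1 + grmon K v2) * y ->
    exists x', x = (grmon K v1 + grmon K v2) * x'.
  elim: s x y => [|i IHi] x y; first by rewrite mul1r => ->; exists y.
  by rewrite exprSr -mulrA => /IHi[x']; apply: binom_coprime.
elim: j c h => [|j IHj] c h; first by exists c; rewrite mul1r.
rewrite exprS -mulrA => e; have [c' ec] := dvd _ _ e.
move: e; rewrite ec mulrCA => /reg/IHj[c'' ->].
by exists c''; rewrite mulrA.
Qed.

(** A term of [h] below [lo], or above [hi - lam u], has to be cancelled in the product by a term of
    [h] one step [u] further out. Repeating this contradicts the finiteness of the support. *)
Lemma binom1_coef_interval u h lo hi : 0 < lam u ->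
  (forall g, grcoef g ((grmon K u + 1) * h) != 0 -> lo <= lam g <= hi) ->
  forall g, grcoef g h != 0 -> lo <= lam g <= hi - 1.
Proof.
move=> lu int; have [M hM] := grcoef_bounded h.
have step g : grcoef g ((grmon K u + 1) * h) = grcoef (g - u) h + grcoef g h.
  by rewrite mulrDl mul1r grcoefD grcoef_monM.
have down g i : lam g < lo -> grcoef g h != 0 -> grcoef (g - u *+ i) h != 0.
  move=> glo gh; elim: i => [|i IHi]; first by rewrite mulr0n subr0.
  have : grcoef (g - u *+ i) ((grmon K u + 1) * h) = 0.
    apply/eqP; apply: contraTT glo => /int /andP[].
    by rewrite raddfB raddfMn /= -mulr_natr natz; move: (lam g) (lam u) lu; nia.
  rewrite step mulrSr opprD addrA => /eqP; rewrite addr_eq0 => /eqP->.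
  by rewrite oppr_eq0.
have up g i : hi - lam u < lam g -> grcoef g h != 0 -> grcoef (g + u *+ i) h != 0.
  move=> ghi gh; elim: i => [|i IHi]; first by rewrite mulr0n addr0.
  have : grcoef (g + u *+ i.+1) ((grmon K u + 1) * h) = 0.
    apply/eqP; apply: contraTT ghi => /int /andP[_].
    by rewrite raddfD raddfMn /= -mulr_natr natz; move: (lam g) (lam u) lu; nia.
  rewrite step mulrSr addrA addrK => e.
  by apply: contraNneq IHi => z; move: e; rewrite z addr0 => ->.
move=> g gh; apply/andP; split.
  rewrite leNgt; apply/negP => glo; have := hM _ (down _ (M.*2.+1) glo gh).
  have := hM _ gh; rewrite raddfB raddfMn /= -mulr_natr natz.
  by move: (lam g) (lam u) lu; nia.
rewrite leNgt; apply/negP => ghi.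
have ghi' : hi - lam u < lam g by lia.
have := hM _ (up _ (M.*2.+1) ghi' gh).
have := hM _ gh; rewrite raddfD raddfMn /= -mulr_natr natz.
by move: (lam g) (lam u) lu; nia.
Qed.

(** Each factor shortens the range of [lam] by at least one, so the length [2M] of a range for [c]
    bounds [s]. *)
Lemma binom1X_dvd_bounded u c : 0 < lam u -> c != 0 ->
  exists w, forall s h, c = (grmon K u + 1) ^+ s * h -> (s <= w)%N.
Proof.
move=> lu c0; have [M cM] := grcoef_bounded c; exists (M.*2)%N => s h ec.
have int g : grcoef g h != 0 -> - M%:Z <= lam g <= M%:Z - s%:Z.
  have : forall g, grcoef g ((grmon K u + 1) ^+ s * h) != 0 -> - M%:Z <= lam g <= M%:Z.
    by move=> x; rewrite -ec => /cM; lia.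
  elim: s h {ec} g => [|s IHs] h g; first by rewrite expr0 mul1r subr0; apply.
  rewrite exprSr -mulrA => /IHs{}IHs /(binom1_coef_interval lu IHs).
  by lia.
have [g gh] : exists g, grcoef g h != 0.
  apply: contrapT => nh; case/eqP: c0; rewrite ec; apply: grcoefP => g.
  rewrite [h](_ : _ = 0) ?mulr0 ?grcoef0 //; apply: grcoefP => x.
  by rewrite grcoef0; apply/eqP; apply: contra_notT nh => xh; exists x.
by have := int _ gh; lia.
Qed.

End Coefficients.
End GroupRingTheory.

(** * Evaluation of Laurent polynomials at nonzero elements of a field *)

Lemma prod_expz_neq0 (n : nat) (F : fieldType) (A : 'I_n -> F) (e : 'I_n -> int) :
  (forall j, A j != 0) -> \prod_j A j ^ e j != 0.
Proof. by move=> A0; apply/prodf_neq0 => j _; rewrite expfz_neq0. Qed.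

Module Export GroupRingEval.
Import finmap monalg.
Local Open Scope fset_scope.
Local Open Scope ring_scope.

Section Pairing.
Variable N : nat.
Implicit Types (w : 'cV[int]_N) (g : 'rV[int]_N).

(** The gradings [lam] used later have this form: a coordinate, or a functional that kills one
    exchange column but not another. *)
Definition pairing w g : int := (g *m w) 0 0.

Lemma pairing_additive w : additive (pairing w).
Proof. by move=> g h; rewrite /pairing mulmxBl !mxE. Qed.

HB.instance Definition _ w :=
  GRing.isAdditive.Build 'rV[int]_N int (pairing w) (pairing_additive w).

Lemma pairing_delta i g : pairing (delta_mx i 0) g = g 0 i.
Proof. by rewrite /pairing -colE mxE. Qed.

End Pairing.

Section Evaluation.
Variables (K : idomainType) (N : nat) (F : fieldType) (io : {rmorphism K -> F}).
Local Notation G := 'rV[int]_N.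
Implicit Types (a : 'I_N -> F) (g u : G) (h : groupring K G).

Definition chi a g : F := \prod_i a i ^ g 0 i.

(** [groupring K 'rV[int]_N] serves as the ring of Laurent polynomials in [N] variables over [K];
    this is the substitution of [a]. *)
Definition gev a h : F := \sum_(g <- msupp h) io (mcoeff g h) * chi a g.

Definition grcmon (c : K) g : groupring K G := << c *g g >>.

Lemma grcmon1 g : grcmon 1 g = grmon K g.
Proof. by []. Qed.

Lemma grcoef_cmon x c g : grcoef x (grcmon c g) = c *+ (g == x).
Proof. exact: mcoeffU. Qed.

Lemma gev_cmon a c g : gev a (grcmon c g) = io c * chi a g.
Proof. exact: (mmapU (f := io)). Qed.

Lemma gev0 a : gev a 0 = 0.
Proof. by rewrite /gev msupp0 big_seq_fset0. Qed.

Lemma gevD a : {morph gev a : h1 h2 / h1 + h2}.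
Proof. exact: (@mmapD _ _ _ io (chi a)). Qed.

Definition grsupp h : seq G := msupp h.

Lemma mem_grsupp g h : (g \in grsupp h) = (grcoef g h != 0).
Proof. by rewrite [RHS]mcoeff_neq0. Qed.

Lemma grsupp_uniq h : uniq (grsupp h).
Proof. exact: fset_uniq. Qed.

Lemma grsum_cmon h : h = \sum_(g <- grsupp h) grcmon (grcoef g h) g.
Proof. exact: monalgE. Qed.

Section Units.
Variable a : 'I_N -> F.
Hypothesis a_neq0 : forall i, a i != 0.

Lemma chi0 : chi a 0 = 1.
Proof. by rewrite /chi big1 // => i _; rewrite mxE expr0z. Qed.

Lemma chiD g u : chi a (g + u) = chi a g * chi a u.
Proof.
by rewrite -big_split; apply: eq_bigr => i _; rewrite mxE expfzDr.
Qed.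

Lemma chiN g : chi a (- g) = (chi a g)^-1.
Proof.
rewrite /chi -prodfV; apply: eq_bigr => i _.
by rewrite mxE -invr_expz.
Qed.

Lemma chiMn g s : chi a (g *+ s) = chi a g ^+ s.
Proof.
elim: s => [|s IHs]; first by rewrite mulr0n chi0 expr0.
by rewrite mulrS chiD IHs exprS.
Qed.

Lemma chi_delta i : chi a (delta_mx 0 i) = a i.
Proof.
rewrite /chi (bigD1 i) //= big1 ?mulr1 => [|j ji].
  by rewrite mxE !eqxx expr1z.
by rewrite mxE eqxx (negPf ji) expr0z.
Qed.

Lemma chi_neq0 g : chi a g != 0.
Proof. exact: (prod_expz_neq0 (fun i => g 0 i)). Qed.

Lemma gev_mon g : gev a (grmon K g) = chi a g.
Proof. by rewrite -grcmon1 gev_cmon rmorph1 mul1r. Qed.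

Lemma gevM : {morph gev a : h1 h2 / h1 * h2}.
Proof.
move=> h1 h2; rewrite -[h1 * h2]/(grmul h1 h2) /grmul.
rewrite [in RHS]/gev big_distrlr /= (big_morph (gev a) (gevD a) (gev0 a)).
apply: eq_bigr => x _; rewrite (big_morph (gev a) (gevD a) (gev0 a)).
apply: eq_bigr => y _; rewrite [gev a _]gev_cmon chiD rmorphM /=; ring.
Qed.

Lemma gev1 : gev a 1 = 1.
Proof. by rewrite -chi0 -gev_mon. Qed.

Lemma gevX h s : gev a (h ^+ s) = gev a h ^+ s.
Proof.
elim: s => [|s IHs]; first exact: gev1.
by rewrite !exprS gevM IHs.
Qed.

End Units.
End Evaluation.
End GroupRingEval.

(** * Exchange of one variable and Laurent rings *)

Section Mutation.
Variables (K : idomainType) (N : nat) (F : fieldType) (io : {rmorphism K -> F}).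
Local Notation G := 'rV[int]_N.
Implicit Types (a : 'I_N -> F) (b g u : G) (h : groupring K G) (k l : 'I_N).

Definition posp b : G := \row_i Num.max (b 0 i) 0.

Definition zero_at k g : G := \row_i if i == k then 0 else g 0 i.

Definition binom a b : F := chi a (posp b) + chi a (posp (- b)).

Definition mut k b a i : F := if i == k then binom a b / a k else a i.

Definition Lring a (f : F) : Prop := exists h, f = gev io a h.

(* Generated by the Laurent monomials free of [a k], by [a k] and by its
   mutation: this turns out to be the intersection of the Laurent rings of two
   adjacent seeds. *)
Inductive Wring a k b : F -> Prop :=
| Wring_const c : Wring a k b (io c)
| Wring_chi0 g : g 0 k = 0 -> Wring a k b (chi a g)
| Wring_var : Wring a k b (a k)
| Wring_mut : Wring a k b (binom a b / a k)
| Wring_add f1 f2 : Wring a k b f1 -> Wring a k b f2 -> Wring a k b (f1 + f2)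
| Wring_mul f1 f2 : Wring a k b f1 -> Wring a k b f2 -> Wring a k b (f1 * f2).

Definition grbinom b : groupring K G := grmon K (posp b) + grmon K (posp (- b)).

Lemma pospB b : posp b - posp (- b) = b.
Proof. by apply/rowP => i; rewrite !mxE; move: (b 0 i) => x; lia. Qed.

Lemma posp_at0 b k : b 0 k = 0 -> posp b 0 k = 0.
Proof. by rewrite mxE => ->. Qed.

Lemma posp_opp_at0 b k : b 0 k = 0 -> posp (- b) 0 k = 0.
Proof. by rewrite !mxE => ->. Qed.

Lemma binomN a b : binom a (- b) = binom a b.
Proof. by rewrite /binom opprK addrC. Qed.

Lemma mutN k b a : mut k (- b) a = mut k b a.
Proof. by apply/funext => i; rewrite /mut binomN. Qed.

Lemma zero_at_at k g : zero_at k g 0 k = 0.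
Proof. by rewrite mxE eqxx. Qed.

Lemma zero_at_ne k l g : l != k -> zero_at k g 0 l = g 0 l.
Proof. by move=> lk; rewrite mxE (negPf lk). Qed.

Lemma chi_split a k g : chi a g = a k ^ g 0 k * chi a (zero_at k g).
Proof.
rewrite /chi (bigD1 k) //= [in RHS](bigD1 k) //= zero_at_at expr0z mul1r.
by congr (_ * _); apply: eq_bigr => i ik; rewrite zero_at_ne.
Qed.

Lemma chi_mut0 a k b g : g 0 k = 0 -> chi (mut k b a) g = chi a g.
Proof.
move=> gk; rewrite /chi; apply: eq_bigr => i _; rewrite /mut.
by case: eqP => [->|//]; rewrite gk !expr0z.
Qed.

Lemma mut_at a k b : mut k b a k = binom a b / a k.
Proof. by rewrite /mut eqxx. Qed.

Lemma mut_ne a k b i : i != k -> mut k b a i = a i.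
Proof. by rewrite /mut => /negPf->. Qed.

Lemma chi_mut a k b g :
  chi (mut k b a) g = (binom a b / a k) ^ g 0 k * chi a (zero_at k g).
Proof. by rewrite (chi_split _ k) mut_at chi_mut0 // zero_at_at. Qed.

Lemma binom_mut a k b (c : G) : c 0 k = 0 -> binom (mut k b a) c = binom a c.
Proof. by move=> ck; rewrite /binom !(chi_mut0 a b) ?posp_opp_at0 ?posp_at0. Qed.

(** As [b 0 k = 0], the binomial is free of [a k] and is the same before and after the exchange. *)
Lemma mutK a k b : b 0 k = 0 -> a k != 0 -> binom a b != 0 ->
  mut k b (mut k b a) = a.
Proof.
move=> bk ak P0; apply/funext => i; rewrite {1}/mut binom_mut // mut_at.
case: eqP => [->|/eqP ik]; last exact: mut_ne.
by field; rewrite ak P0.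
Qed.

Lemma Lring_ind (Q : F -> Prop) a : Q 0 ->
  (forall c g, Q (io c * chi a g)) ->
  (forall f1 f2, Q f1 -> Q f2 -> Q (f1 + f2)) ->
  forall f, Lring a f -> Q f.
Proof.
move=> Q0 Qm QD _ [h ->]; rewrite [h]grsum_cmon.
rewrite (big_morph (gev io a) (gevD io a) (gev0 io a)).
by apply: big_ind => // g _; rewrite gev_cmon.
Qed.

Lemma LringD a f1 f2 : Lring a f1 -> Lring a f2 -> Lring a (f1 + f2).
Proof. by move=> [h1 ->] [h2 ->]; exists (h1 + h2); rewrite gevD. Qed.

Lemma Lring0 a : Lring a 0.
Proof. by exists 0; rewrite gev0. Qed.

Section Seed.
Variables (a : 'I_N -> F) (k : 'I_N) (b : G).
Hypotheses (a0 : forall i, a i != 0) (bk : b 0 k = 0).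

Lemma LringM f1 f2 : Lring a f1 -> Lring a f2 -> Lring a (f1 * f2).
Proof. by move=> [h1 ->] [h2 ->]; exists (h1 * h2); rewrite gevM. Qed.

Lemma Lring_chi g : Lring a (chi a g).
Proof. by exists (grmon K g); rewrite gev_mon. Qed.

Lemma Lring_const c : Lring a (io c).
Proof. by exists (grcmon c 0); rewrite gev_cmon chi0 mulr1. Qed.

Lemma gev_binom (c : G) : gev io a (grbinom c) = binom a c.
Proof. exact: etrans (gevD io a _ _) (congr2 +%R (gev_mon _ _ _) (gev_mon _ _ _)). Qed.

Lemma Lring_binom (c : G) : Lring a (binom a c).
Proof. by rewrite -gev_binom; exists (grbinom c). Qed.

Lemma Lring_var i (z : int) : Lring a (a i ^ z).
Proof.
rewrite -(chi_delta a i); case: z => s; last rewrite NegzE -exprnN.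
  by rewrite -exprnP -chiMn //; apply: Lring_chi.
by rewrite -chiMn // -chiN //; apply: Lring_chi.
Qed.

Lemma Wring1 : Wring a k b 1.
Proof. by rewrite -(rmorph1 io); exact: Wring_const. Qed.

Lemma Wring0 : Wring a k b 0.
Proof. by rewrite -(rmorph0 io); exact: Wring_const. Qed.

Lemma WringX f s : Wring a k b f -> Wring a k b (f ^+ s).
Proof.
move=> Wf; elim: s => [|s IHs]; first exact: Wring1.
by rewrite exprS; apply: Wring_mul.
Qed.

Lemma WringN f : Wring a k b f -> Wring a k b (- f).
Proof.
move=> Wf; rewrite -mulN1r -(rmorph1 io) -rmorphN; apply: Wring_mul => //.
exact: Wring_const.
Qed.

Lemma Wring_sum (I : Type) (r : seq I) (E : I -> F) :
  (forall i, Wring a k b (E i)) -> Wring a k b (\sum_(i <- r) E i).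
Proof. by move=> WE; apply: big_ind => //; [exact: Wring0 | exact: Wring_add]. Qed.

Lemma Wring_chi g : 0 <= g 0 k -> Wring a k b (chi a g).
Proof.
move=> gk; rewrite (chi_split a k); apply: Wring_mul.
  by rewrite -(gez0_abs gk); apply: WringX; apply: Wring_var.
by apply: Wring_chi0; rewrite zero_at_at.
Qed.

Lemma Wring_gev h : (forall g, grcoef g h != 0 -> 0 <= g 0 k) ->
  Wring a k b (gev io a h).
Proof.
move=> hk; rewrite [h]grsum_cmon (big_morph (gev io a) (gevD io a) (gev0 io a)).
apply: Wring_sum => g; rewrite gev_cmon.
have [->|/hk gk] := eqVneq (grcoef g h) 0.
  by rewrite rmorph0 mul0r; exact: Wring0.
by apply: Wring_mul; [apply: Wring_const | apply: Wring_chi].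
Qed.

Lemma Wring_clear f : Lring a f -> exists s, Wring a k b (a k ^+ s * f).
Proof.
apply: (@Lring_ind (fun f => exists s, Wring a k b (a k ^+ s * f))).
- by exists 0%N; rewrite mulr0; exact: Wring0.
- move=> c g; exists (absz (g 0 k)).
  rewrite mulrCA; apply: Wring_mul; first exact: Wring_const.
  rewrite -(chi_delta a k) -chiMn // -chiD //; apply: Wring_chi.
  rewrite mxE -scaler_nat !mxE !eqxx natz /=; lia.
- move=> f1 f2 [s1 W1] [s2 W2]; exists (s1 + s2)%N.
  have -> : a k ^+ (s1 + s2) * (f1 + f2)
      = a k ^+ s2 * (a k ^+ s1 * f1) + a k ^+ s1 * (a k ^+ s2 * f2)
    by rewrite exprD; ring.
  by apply: Wring_add; apply: Wring_mul => //; apply: WringX; exact: Wring_var.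
Qed.

End Seed.

(** Negating the column only swaps the terms of the binomial; this reduces one sign case of the
    exchange argument to the other. *)
Lemma WringNb a k b f : Wring a k (- b) f -> Wring a k b f.
Proof.
elim=> [c|g gk|||f1 f2 _ ? _ ?|f1 f2 _ ? _ ?].
- exact: Wring_const.
- exact: Wring_chi0.
- exact: Wring_var.
- by rewrite binomN; exact: Wring_mut.
- exact: Wring_add.
- exact: Wring_mul.
Qed.

Lemma mut_neq0 a k b : (forall i, a i != 0) -> binom a b != 0 ->
  forall i, mut k b a i != 0.
Proof.
move=> a0 P0 i; rewrite /mut; case: ifP => // _.
by rewrite mulf_neq0 ?invr_eq0.
Qed.

(** The easy inclusion, checked on generators: [a k] is the binomial divided by the mutated
    variable. *)
Lemma Wring_Lring_mut a k b f : (forall i, a i != 0) -> b 0 k = 0 ->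
  binom a b != 0 -> Wring a k b f -> Lring (mut k b a) f.
Proof.
move=> a0 bk P0; have a10 := mut_neq0 k a0 P0.
elim=> [c|g gk|||f1 f2 _ ? _ ?|f1 f2 _ ? _ ?].
- exact: Lring_const.
- by rewrite -(chi_mut0 a b gk); apply: Lring_chi.
- have -> : a k = mut k b (mut k b a) k by rewrite mutK.
  rewrite mut_at; apply: LringM => //.
    exact: Lring_binom.
  by have := Lring_var a10 k (-1); rewrite exprN1.
- by have := Lring_var a10 k 1; rewrite expr1z mut_at.
- exact: LringD.
- exact: LringM.
Qed.

End Mutation.

(** * Elements that are Laurent in two adjacent clusters *)

Section Components.
Variables (K : idomainType) (N : nat) (F : fieldType) (io : {rmorphism K -> F}).
Local Notation G := 'rV[int]_N.
(* Otherwise failing conversions unfold the convolution product and diverge. *)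
#[local] Opaque grmul grcoef grpart grmon grcmon gev chi GRing.exp.
Implicit Types (a : 'I_N -> F) (b g u : G) (h : groupring K G) (k l : 'I_N).

(** Algebraic independence over [K], stated for Laurent polynomials; it forces every [a i] to be
    nonzero. *)
Definition free_family a := forall h, gev io a h = 0 -> h = 0.

Definition level k (z : int) : pred G := fun g => g 0 k == z.

Lemma grbinom_neq0 b : b != 0 -> grbinom K b != 0.
Proof.
apply: contraNneq => /(congr1 (grcoef (posp b))); rewrite grcoefD grcoef0.
rewrite [X in X + _]grcoef_mon [X in _ + X]grcoef_mon eqxx.
case: eqP => [e|_] /eqP.
  by rewrite -(pospB b) e subrr.
by rewrite addr0 oner_eq0.
Qed.

Lemma free_inj a h1 h2 : free_family a -> gev io a h1 = gev io a h2 -> h1 = h2.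
Proof.
move=> fa e; apply: subr0_eq; apply: fa; apply: (addIr (gev io a h2)).
by rewrite -gevD subrK add0r.
Qed.

Lemma free_neq0 a : free_family a -> forall i, a i != 0.
Proof.
move=> fa i; rewrite -(chi_delta a i) -(gev_mon io); apply/eqP => /fa.
move/(congr1 (grcoef (delta_mx 0 i))); rewrite grcoef_mon eqxx grcoef0 => /eqP.
by rewrite oner_eq0.
Qed.

Lemma binom_neq0 a b : free_family a -> b != 0 -> binom a b != 0.
Proof.
move=> fa /grbinom_neq0; apply: contraNneq => e; apply/eqP/fa.
by rewrite gev_binom //; exact: free_neq0.
Qed.

Lemma grpart_cmon (D : pred G) (c : K) g :
  grpart D (grcmon c g) = if D g then grcmon c g else 0.
Proof.
apply: grcoefP => x; rewrite grcoef_part (fun_if (grcoef x)) grcoef0 !grcoef_cmon.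
by have [->|_] := eqVneq g x; rewrite ?mulr0n ?if_same.
Qed.

Lemma grpart_grbinomX k b z s h : b 0 k = 0 ->
  grpart (level k z) (grbinom K b ^+ s * h)
    = grbinom K b ^+ s * grpart (level k z) h.
Proof.
move=> bk; apply: grpart_binomXM => g;
  by rewrite /level mxE ?(posp_opp_at0 bk) ?(posp_at0 bk) addr0.
Qed.

Lemma gev_grbinomXM a b s h : (forall i, a i != 0) ->
  gev io a (grbinom K b ^+ s * h) = binom a b ^+ s * gev io a h.
Proof. by move=> a0; rewrite (gevM io a0 (_ ^+ s)) (gevX io a0) gev_binom. Qed.

(** With [P] the binomial, the power [z] of the mutated variable is [P^z] times the power [-z] of
    [a k]. Hence a term of degree [-j] in [a k] carries [P^j]; the factor [P^s] clears the
    denominators that come from negative [z]. *)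
Lemma Lring_mut_components a k b f : (forall i, a i != 0) -> b 0 k = 0 ->
  binom a b != 0 -> Lring io (mut k b a) f ->
  exists s h, binom a b ^+ s * f = gev io a h /\
    forall j : nat, exists e,
      grpart (level k (- j%:Z)) h = grbinom K b ^+ (s + j) * e.
Proof.
move=> a0 bk P0; apply: (@Lring_ind _ _ _ io (fun f => exists s h,
  binom a b ^+ s * f = gev io a h /\ forall j : nat, exists e,
      grpart (level k (- j%:Z)) h = grbinom K b ^+ (s + j) * e)).
- exists 0%N, 0; rewrite mulr0 gev0; split=> // j; exists 0; rewrite mulr0.
  by apply: grcoefP => x; rewrite grcoef_part grcoef0 if_same.
- move=> c g; rewrite chi_mut.
  (* [g'] is the exponent of the monomial left once the power of the binomial is split off. *)
  pose g' : G := zero_at k g - delta_mx 0 k *~ g 0 k.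
  have g'k : g' 0 k = - g 0 k.
    by rewrite /g' -scaler_int !mxE !eqxx /= mulr1 add0r intz.
  have g'E : chi a g' = (a k)^-1 ^ g 0 k * chi a (zero_at k g).
    rewrite (chi_split a k) g'k exprz_inv; congr (_ * chi a _).
    apply/rowP => i; rewrite /g' -scaler_int !mxE; case: eqP => //= _.
    by rewrite mulr0 subr0.
  rewrite expfzMl -mulrA -g'E.
  case: (intP (g 0 k)) g'k {g'E} => [|s|s] g'k.
  + exists 0%N, (grcmon c g'); rewrite expr0z mul1r expr0 mul1r gev_cmon.
    split=> // j; rewrite grpart_cmon /level.
    case: eqP => [e|_]; last by exists 0; rewrite mulr0.
    exists (grcmon c g'); have -> : j = 0%N by move: e; rewrite g'k; lia.
    by rewrite expr0 mul1r.
  + exists 0%N, (grbinom K b ^+ s.+1 * grcmon c g').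
    rewrite expr0 mul1r (gev_grbinomXM _ _ _ a0) gev_cmon; split.
      by rewrite -exprnP mulrCA.
    move=> j; rewrite grpart_grbinomX // grpart_cmon /level.
    case: eqP => [e|_]; last by exists 0; rewrite !mulr0.
    by exists (grcmon c g'); have -> : j = s.+1 by move: e; rewrite g'k; lia.
  + exists s.+1, (grcmon c g'); rewrite -exprnN gev_cmon; split.
      by rewrite mulrCA mulVKf ?expf_neq0.
    move=> j; rewrite grpart_cmon /level.
    case: eqP => [e|_]; last by exists 0; rewrite mulr0.
    by move: e; rewrite g'k; lia.
- move=> f1 f2 [s1 [h1 [e1 d1]]] [s2 [h2 [e2 d2]]].
  exists (s1 + s2)%N, (grbinom K b ^+ s2 * h1 + grbinom K b ^+ s1 * h2); split.
    rewrite gevD mulrDr exprD; congr (_ + _).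
      by rewrite (gev_grbinomXM b s2 h1 a0) -e1 mulrA [_ ^+ s1 * _]mulrC.
    by rewrite (gev_grbinomXM b s1 h2 a0) -e2 mulrA.
  move=> j; have [x1 p1] := d1 j; have [x2 p2] := d2 j.
  exists (x1 + x2); rewrite grpartD mulrDr; congr (_ + _).
    rewrite (grpart_grbinomX _ s2 h1 bk) p1 mulrA -exprD addnA.
    rewrite [(s2 + s1)%N]addnC; reflexivity.
  rewrite (grpart_grbinomX _ s1 h2 bk) p2 mulrA -exprD addnA.
  reflexivity.
Qed.

(** The expansion in [a] is unique by freeness, so the auxiliary power of the binomial cancels in
    each component. *)
Lemma Lring_inter_components a k b h : free_family a -> b 0 k = 0 -> b != 0 ->
  Lring io (mut k b a) (gev io a h) ->
  forall j : nat, exists e, grpart (level k (- j%:Z)) h = grbinom K b ^+ j * e.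
Proof.
move=> fa bk b0 Lf j; have a0 := free_neq0 fa.
have [s [h2 [e2 /(_ j)[e d]]]] := Lring_mut_components a0 bk (binom_neq0 fa b0) Lf.
exists e; apply: (mulfI (expf_neq0 s (grbinom_neq0 b0))).
rewrite -(grpart_grbinomX _ _ _ bk) mulrA -exprD -d; congr (grpart _ _).
by apply: (free_inj fa); rewrite gevM // gevX // gev_binom.
Qed.

(** The [j]-th power of the binomial divided by that of [a k] is a power of the mutated variable.
    The induction on [M] peels off the component of lowest degree. *)
Lemma Wring_components a k b h : (forall i, a i != 0) -> b 0 k = 0 ->
  (forall j : nat, exists e, grpart (level k (- j%:Z)) h = grbinom K b ^+ j * e) ->
  Wring io a k b (gev io a h).
Proof.
move=> a0 bk; have [M hM'] := grcoef_bounded (pairing (delta_mx k 0)) h.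
have {hM'} : forall g, grcoef g h != 0 -> - M%:Z <= g 0 k.
  by move=> g /hM'; rewrite /= pairing_delta; move: (g 0 k) => x; lia.
elim: M h => [|M IHM] h hM hd.
  by apply: Wring_gev => // g /hM; rewrite oppr0.
pose z : int := - (M.+1)%:Z.
pose h1 := grpart (level k z) h; pose h2 := grpart (predC (level k z)) h.
rewrite -(grpart_predC (level k z) h) -/h1 -/h2 gevD; apply: Wring_add; last first.
  apply: IHM => [g|j].
    rewrite /h2 grcoef_part /=; case: ifP; rewrite ?eqxx // /level /z => zg /hM.
    by move: (g 0 k) zg => x; lia.
  have [->|jM] := eqVneq j M.+1.
    by exists 0; rewrite mulr0 /h2 grpart_disj.
  have [e he] := hd j; exists e; rewrite -he /h2 grpart_sub // => g.
  rewrite /level /z /=.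
  by move: (g 0 k) => x /eqP->; rewrite eqr_opp eqz_nat.
have [e he] := hd M.+1.
(* Only the part of [e] of degree [-(M+1)] contributes; the shift by [u] below brings it to degree 0
   in [a k]. *)
have -> : h1 = grbinom K b ^+ M.+1 * grpart (level k z) e.
  by rewrite -(grpart_grbinomX _ _ _ bk) -he grpart_id.
rewrite (gev_grbinomXM _ _ _ a0).
pose u : G := delta_mx 0 k *+ M.+1.
have uk : u 0 k = (M.+1)%:Z by rewrite /u -scaler_nat !mxE !eqxx mulr1 natz.
have -> : gev io a (grpart (level k z) e)
    = (a k)^-1 ^+ M.+1 * gev io a (grmon K u * grpart (level k z) e).
  rewrite (gevM io a0 (grmon K u)) gev_mon /u (chiMn a0) chi_delta.
  by rewrite mulrA -exprMn mulVf // expr1n mul1r.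
rewrite mulrA -exprMn; apply: Wring_mul; first by apply: WringX; exact: Wring_mut.
apply: Wring_gev => // g; rewrite grcoef_monM grcoef_part.
case: ifP; rewrite ?eqxx // /level !mxE uk /z.
by move: (g 0 k) => x; lia.
Qed.

Lemma Lring_inter_Wring a k b f : free_family a -> b 0 k = 0 -> b != 0 ->
  Lring io a f -> Lring io (mut k b a) f -> Wring io a k b f.
Proof.
move=> fa bk b0 [h ->] Lf; apply: Wring_components => //; first exact: free_neq0.
exact: (Lring_inter_components fa bk b0 Lf).
Qed.

End Components.

(** * Two exchange directions: carrying Laurentness in direction [k] across a mutation at [l] *)

Section Adjacent.
Variables (K : idomainType) (N : nat) (F : fieldType) (io : {rmorphism K -> F}).
Local Notation G := 'rV[int]_N.
Implicit Types (a : 'I_N -> F) (b bl bk g u : G) (k l : 'I_N).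

(** Matrix mutation at [l] of a column [b] other than column [l], which is [bl]; frozen rows obey
    the same rule. *)
Definition mutcol l bl b : G := \row_i
  if i == l then - b 0 l else b 0 i + Num.sg (bl 0 i) * Num.max (bl 0 i * b 0 l) 0.

Lemma mutcolN l bl b : mutcol l (- bl) (- b) = - mutcol l bl b.
Proof.
apply/rowP => i; rewrite !mxE; case: ifP => // _.
by rewrite mulrNN sgrN mulNr opprD.
Qed.

(** For [c > 0], the correction [sg x * max (x c) 0] equals [c * max x 0]. Row [l], where mutation
    reverses the sign, is given back its old entry. *)
Lemma mutcol_pos l bl b : 0 < b 0 l -> bl 0 l = 0 ->
  zero_at l (mutcol l bl b) + delta_mx 0 l *~ b 0 l = b + posp bl *~ b 0 l.
Proof.
move=> c0 bll; apply/rowP => i; rewrite -!scaler_int !mxE eqxx !intz /=.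
case: eqP => [->|_]; first by rewrite bll maxxx mulr0 addr0 mulr1 add0r.
rewrite mulr0 addr0; congr (_ + _).
case: (sgrP (bl 0 i)) => x0.
- by rewrite mul0r x0 maxxx mulr0.
- by rewrite mul1r !max_l ?mulr_ge0 ?ltW // mulrC.
- by rewrite !max_r ?mulr0 ?ltW // nmulr_rlt0.
Qed.

Section Exchange.
Variables (a : 'I_N -> F) (k l : 'I_N) (bk bl : G).
Hypotheses (a0 : forall i, a i != 0) (kl : k != l).
Hypotheses (bkk : bk 0 k = 0) (bll : bl 0 l = 0) (P0 : binom a bl != 0).
Let a1 := mut l bl a.
Let bk' := mutcol l bl bk.
Let a10 : forall i, a1 i != 0 := mut_neq0 l a0 P0.

Let a1k : a1 k = a k. Proof. exact: mut_ne. Qed.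

(** Under mutation at [l] the quotient of the two exchange monomials at [k], the usual hatted
    variable, is multiplied by [(p / P)^c], where [p = chi a (posp bl)], [P] is the binomial at [l]
    and [c = bk 0 l]. Denominators are cleared here. *)
Lemma mutcol_ratio (s : nat) : bk 0 l = s.+1%:Z ->
  chi a1 (posp bk') * chi a (posp (- bk)) * binom a bl ^+ s.+1
    = chi a1 (posp (- bk')) * chi a (posp bk) * chi a (posp bl) ^+ s.+1.
Proof.
move=> bkl.
have e1 : chi a1 bk' * binom a bl ^+ s.+1 = chi a bk * chi a (posp bl) ^+ s.+1.
  have := congr1 (chi a) (mutcol_pos (bl := bl) (b := bk) (l := l) _ bll).
  rewrite bkl => /(_ isT); rewrite -!pmulrn !chiD // !chiMn // chi_delta => <-.
  rewrite [chi a1 _](chi_mut a l bl) {2}/bk' mxE eqxx bkl -exprnN -/bk'.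
  by rewrite expr_div_n; field; rewrite !expf_neq0.
have e2 : chi a1 (posp bk') = chi a1 bk' * chi a1 (posp (- bk')).
  by rewrite -chiD // -{2}(pospB bk') subrK.
have e3 : chi a (posp bk) = chi a bk * chi a (posp (- bk)).
  by rewrite -chiD // -{2}(pospB bk) subrK.
rewrite e2 e3; transitivity (chi a1 bk' * binom a bl ^+ s.+1
  * (chi a1 (posp (- bk')) * chi a (posp (- bk)))); first by ring.
by rewrite e1; ring.
Qed.

Lemma Wring_chi_l g : g 0 l = 0 -> 0 <= g 0 k -> Wring io a1 k bk' (chi a g).
Proof. by move=> gl gk; rewrite -(chi_mut0 a bl gl); apply: Wring_chi. Qed.

(* Up to invertible monomials, the two exchange relations at [k] differ by
   [P^c - (P^+)^c], where [P] is the binomial at [l] and [P^+] its term free of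
   [a k]; this difference is divisible by [a k]. *)
Lemma Wring_mut_exchange : 0 < bk 0 l -> bl 0 k < 0 ->
  Wring io a1 k bk' (binom a bk / a k).
Proof.
move=> bkl0 blk; have [s bkl] : exists s : nat, bk 0 l = s.+1%:Z.
  by exists (absz (bk 0 l)).-1; move: (bk 0 l) bkl0 => x; lia.
have ratio := mutcol_ratio bkl.
have posp0 (g : G) i : g 0 i <= 0 -> posp g 0 i = 0 by rewrite mxE => /max_r.
have bk'k : bk' 0 k = 0.
  by rewrite mxE (negPf kl) bkk add0r max_r ?mulr0 // nmulr_rle0 // bkl.
have Wp : Wring io a1 k bk' (chi a (posp bl)).
  by apply: Wring_chi_l; rewrite posp0 ?bll // ltW.
have Wq : Wring io a1 k bk' (chi a (posp (- bl))).
  by apply: Wring_chi_l; rewrite ?(posp_opp_at0 bll) // mxE le_max lexx orbT.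
have WP : Wring io a1 k bk' (binom a bl) by apply: Wring_add.
have Wpinv : Wring io a1 k bk' (chi a (posp bl))^-1.
  by rewrite -chiN //; apply: Wring_chi_l; rewrite mxE posp0 ?bll ?oppr0 // ltW.
have Wm : Wring io a1 k bk' (chi a (posp (- bk))).
  apply: Wring_chi_l; rewrite ?(posp_opp_at0 bkk) // posp0 // mxE bkl; lia.
have Wninv : Wring io a1 k bk' (chi a1 (posp (- bk')))^-1.
  by rewrite -chiN //; apply: Wring_chi0; rewrite mxE (posp_opp_at0 bk'k) oppr0.
(* Since [bl 0 k < 0], this term of the binomial at [l] contains [a k]. *)
have Wqy : Wring io a1 k bk' (chi a (posp (- bl)) / a k).
  rewrite -(chi_delta a k) -chiN // -chiD //; apply: Wring_chi_l.
    by rewrite mxE (posp_opp_at0 bll) !mxE eqxx eq_sym (negPf kl) oppr0 addr0.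
  by move: blk; rewrite !mxE !eqxx /=; move: (bl 0 k) => x; lia.
have := subrXX (binom a bl) (chi a (posp bl)) s.+1.
set T := \sum_(i < _) _ => eT.
have WT : Wring io a1 k bk' T.
  by apply: Wring_sum => i; apply: Wring_mul; apply: WringX.
(* Expand the mutated binomial into its two terms. Up to the common factors, one gives the first
   term of [binom a bk] by [mutcol_ratio], and the other exceeds the second term by the multiple of
   [T] that is subtracted. *)
suff -> : binom a bk / a k = (chi a (posp bl))^-1 ^+ s.+1 *
    (binom a bl ^+ s.+1 * (chi a (posp (- bk)) / chi a1 (posp (- bk'))
       * (binom a1 bk' / a1 k))
     + - (chi a (posp (- bk)) * (chi a (posp (- bl)) / a k * T))).
  apply: Wring_mul; first exact: WringX.
  apply: Wring_add; last by apply: WringN; apply: Wring_mul => //; apply: Wring_mul.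
  apply: Wring_mul; first exact: WringX.
  by apply: Wring_mul; [apply: Wring_mul | apply: Wring_mut].
have {}eT : chi a (posp (- bl)) * T
    = binom a bl ^+ s.+1 - chi a (posp bl) ^+ s.+1.
  by rewrite eT /binom addrC addKr.
rewrite [_ / a k * T]mulrAC eT a1k.
move: ratio (chi_neq0 a0 (posp bl)) (chi_neq0 a10 (posp (- bk'))) (a0 k).
move: {WP Wp Wq} (binom a bl ^+ s.+1) => Pn; rewrite exprVn /binom.
move: (chi a (posp bl)) => p.
move: (chi a1 _) (chi a1 _) (chi a _) (chi a _) (a k) => n1 n2 m2 m1 y ratio p0 n20 y0.
have pn0 : p ^+ s.+1 != 0 by rewrite expf_neq0.
move: (p ^+ s.+1) ratio pn0 => pn ratio pn0.
have -> : m2 = n2 * m1 * Pn / (n1 * pn) by rewrite ratio; field; rewrite n20 pn0.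
by field; rewrite n20 y0 pn0.
Qed.

Lemma Wring_binom_l b : Wring io a1 k b (binom a bl).
Proof.
rewrite -(binom_mut a bl bll); apply: Wring_add; apply: Wring_chi => //.
  by rewrite mxE le_max lexx orbT.
by rewrite mxE le_max lexx orbT.
Qed.

(** Checked on generators. Only negative powers of [a l] need the factor, because [a l] is the
    binomial at [l] divided by [a1 l]. *)
Lemma Wring_clear_l b f : Wring io a1 k b (binom a bk / a k) ->
  Wring io a k bk f -> exists s, Wring io a1 k b (binom a bl ^+ s * f).
Proof.
move=> Wmut; have WP := Wring_binom_l b.
elim=> [c|g gk|||f1 f2 _ [s1 W1] _ [s2 W2]|f1 f2 _ [s1 W1] _ [s2 W2]].
- by exists 0%N; rewrite mul1r; apply: Wring_const.
- have al : a l = binom a bl * (a1 l)^-1.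
    by rewrite /a1 mut_at invf_div mulrCA mulfV ?mulr1.
  have W0 : Wring io a1 k b (chi a (zero_at l g)).
    rewrite -(chi_mut0 a bl (zero_at_at l g)); apply: Wring_chi0.
    by rewrite zero_at_ne.
  have a1l : a1 l = chi a1 (delta_mx 0 l) by rewrite chi_delta.
  have lk0 : (delta_mx 0 l : G) 0 k = 0 by rewrite mxE eqxx (negPf kl).
  rewrite (chi_split a l); case: (g 0 l) => s.
    exists 0%N; rewrite mul1r; apply: Wring_mul => //; apply: WringX.
    rewrite al; apply: Wring_mul => //; rewrite a1l -chiN //.
    by apply: Wring_chi0; rewrite mxE lk0 oppr0.
  exists s.+1; rewrite mulrA; apply: Wring_mul => //.
  rewrite NegzE -exprnN al exprMn exprVn.
  have -> : binom a bl ^+ s.+1 / (binom a bl ^+ s.+1 / a1 l ^+ s.+1) = a1 l ^+ s.+1.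
    by field; rewrite !expf_neq0.
  by apply: WringX; rewrite a1l; apply: Wring_chi0.
- by exists 0%N; rewrite mul1r -a1k; apply: Wring_var.
- by exists 0%N; rewrite mul1r.
- exists (s1 + s2)%N; rewrite exprD mulrDr; apply: Wring_add.
    by rewrite mulrAC mulrC; apply: Wring_mul => //; apply: WringX.
  by rewrite -mulrA; apply: Wring_mul => //; apply: WringX.
- by exists (s1 + s2)%N; rewrite exprD mulrACA; apply: Wring_mul.
Qed.

(** One term of the binomial is a unit free of [a k], the other is divisible by [a k]; dividing by
    the unit gives the relation. *)
Lemma Wring_comaximal b : bl 0 k < 0 -> exists al be,
  [/\ Wring io a1 k b al, Wring io a1 k b be
    & al * binom a bl + be * a k = 1].
Proof.
move=> blk; pose pinv := (chi a (posp bl))^-1.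
have Wchi g : g 0 l = 0 -> 0 <= g 0 k -> Wring io a1 k b (chi a g).
  by move=> gl gk; rewrite -(chi_mut0 a bl gl); apply: Wring_chi.
have Wp : Wring io a1 k b pinv.
  rewrite /pinv -chiN //; apply: Wchi; first by rewrite mxE (posp_at0 bll) oppr0.
  by rewrite mxE [posp bl 0 k]mxE (max_r (ltW blk)) oppr0.
exists pinv, (- (pinv * (chi a (posp (- bl)) / a k))); split=> //.
  apply: WringN; apply: Wring_mul => //.
  rewrite -(chi_delta a k) -chiN // -chiD //; apply: Wchi.
    by rewrite mxE (posp_opp_at0 bll) !mxE eqxx eq_sym (negPf kl) oppr0 addr0.
  by move: blk; rewrite !mxE !eqxx /=; move: (bl 0 k) => x; lia.
have p0 := chi_neq0 a0 (posp bl).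
by rewrite /pinv /binom; field; rewrite p0 a0.
Qed.

End Exchange.
(** When [a k * f'] is in the ring, multiplying by [1 = al * P + be * a k] lowers by one the power
    of [P] needed for [f']. So the factors [a k] can be removed one after the other. *)
Lemma Wring_saturated a k b P f s t al be :
  Wring io a k b al -> Wring io a k b be -> Wring io a k b P ->
  al * P + be * a k = 1 ->
  Wring io a k b (P ^+ s * f) -> Wring io a k b (a k ^+ t * f) ->
  Wring io a k b f.
Proof.
move=> Wal Wbe WP e WPf; have one_step s' f' : Wring io a k b (P ^+ s' * f') ->
    Wring io a k b (a k * f') -> Wring io a k b f'.
  move=> + Wf; elim: s' => [|s' IHs]; first by rewrite mul1r.
  move=> WPf'; apply: IHs; rewrite -[_ * f']mul1r -e.
  have -> : (al * P + be * a k) * (P ^+ s' * f')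
      = al * (P ^+ s'.+1 * f') + be * (P ^+ s' * (a k * f')).
    by rewrite exprS; ring.
  apply: Wring_add; apply: Wring_mul => //.
  by apply: Wring_mul => //; apply: WringX.
elim: t => [|t IHt]; first by rewrite mul1r.
rewrite exprS -mulrA => Wt; apply/IHt/(one_step s) => //.
by rewrite mulrCA; apply: Wring_mul => //; apply: WringX; apply: Wring_var.
Qed.

(** In degree [-j] in [a k], the component of [f] times a power of the binomial of [c] is divisible
    by the [j]-th power of that of [b]. The functional [w] separates the two binomials, so
    [binomX_coprime] removes the first. *)
Lemma Wring_coprime a k b (c : G) (w : 'cV[int]_N) s f : free_family io a ->
  b 0 k = 0 -> c 0 k = 0 -> b != 0 -> pairing w b = 0 -> pairing w c != 0 ->
  Lring io a f -> Wring io a k b (binom a c ^+ s * f) -> Wring io a k b f.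
Proof.
move=> fa bk ck b0 wb wc [h ->] W; have a0 := free_neq0 fa.
have pairE (x : G) : pairing w (posp x) - pairing w (posp (- x)) = pairing w x.
  by rewrite -raddfB pospB.
apply: Wring_components => // j.
have := Wring_Lring_mut a0 bk (binom_neq0 fa b0) W.
rewrite -(gev_grbinomXM io _ _ _ a0).
move=> /(Lring_inter_components fa bk b0)/(_ j)[e].
rewrite (grpart_grbinomX _ _ _ ck) => eq.
apply: (binomX_coprime (lam := pairing w) _ _ _ eq).
- by apply/eqP; rewrite -subr_eq0 pairE wb.
- by rewrite -subr_eq0 pairE.
- exact: mulfI (grbinom_neq0 _ b0).
Qed.

(** The sign pattern that skew-symmetrizability imposes on the entries [(l, k)] and [(k, l)]; not
    the sign-coherence of c-vectors. *)
Definition sign_coherent k l bk bl : Prop :=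
  [\/ 0 < bk 0 l /\ bl 0 k < 0, bk 0 l < 0 /\ 0 < bl 0 k
    | bk 0 l = 0 /\ bl 0 k = 0].

Lemma mutcol_id l bl b : b 0 l = 0 -> mutcol l bl b = b.
Proof.
move=> bll; apply/rowP => i; rewrite !mxE bll; case: eqP => [->|_].
  by rewrite bll oppr0.
by rewrite mulr0 maxxx mulr0 addr0.
Qed.

Theorem Lring_mut_mut a k l bk bl f (bk' := mutcol l bl bk) (a1 := mut l bl a) :
  free_family io a -> free_family io a1 -> k != l ->
  bk 0 k = 0 -> bl 0 l = 0 -> sign_coherent k l bk bl ->
  bk != 0 -> bl != 0 -> bk' != 0 ->
  (exists w : 'cV[int]_N, pairing w bk = 0 /\ pairing w bl != 0) ->
  Lring io a f -> Lring io a1 f -> Lring io (mut k bk a) f ->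
  Lring io (mut k bk' a1) f.
Proof.
move=> fa fa1 kl bkk bll sgn bk0 bl0 bk'0 [w [wk wl]] Lf L1f Lkf.
have a0 := free_neq0 fa; have a10 := free_neq0 fa1.
have P0 := binom_neq0 fa bl0; have a1k : a1 k = a k by apply: mut_ne.
have bk'k : bk' 0 k = 0.
  rewrite mxE (negPf kl) bkk add0r max_r ?mulr0 //.
  case: sgn => [[x y]|[x y]|[-> ->]] //.
    by rewrite nmulr_rle0 // ltW.
  by rewrite pmulr_rle0 // ltW.
suff W1 : Wring io a1 k bk' f.
  exact: Wring_Lring_mut (binom_neq0 fa1 bk'0) W1.
have [s Ws] : exists s, Wring io a1 k bk' (binom a bl ^+ s * f).
  apply: (Wring_clear_l a0 kl bll P0 (bk := bk)); last exact: Lring_inter_Wring.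
  case: sgn => [[x y]|[x y]|[x y]].
  - exact: Wring_mut_exchange.
  (* Negating both columns leads to the previous sign case and leaves binomials and exchanged
     variables unchanged. *)
  - apply: WringNb; rewrite -mutcolN -(binomN a bk) /a1 -mutN.
    apply: Wring_mut_exchange => //; rewrite ?binomN //.
    + by rewrite mxE bkk oppr0.
    + by rewrite mxE bll oppr0.
    + by rewrite mxE oppr_gt0.
    + by rewrite mxE oppr_lt0.
  (* Here mutation at [l] changes neither column [k] nor its binomial, so the exchanges at [k]
     before and after it give the same variable. *)
  - rewrite /bk' mutcol_id // -(binom_mut a bl x) -a1k; exact: Wring_mut.
have WP b : Wring io a1 k b (binom a bl) by apply: Wring_binom_l.
have [t Wt] : exists t, Wring io a1 k bk' (a1 k ^+ t * f) by apply: Wring_clear.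
case: (sgn) => [[x y]|[x y]|[x y]].
- have [al [be [Wal Wbe e]]] : exists al be, [/\ Wring io a1 k bk' al,
    Wring io a1 k bk' be & al * binom a bl + be * a k = 1].
    by apply: (Wring_comaximal (bk := bk)).
  by apply: (Wring_saturated Wal Wbe (WP bk') _ Ws Wt); rewrite a1k.
- have [al [be [Wal Wbe e]]] : exists al be, [/\ Wring io a1 k bk' al,
    Wring io a1 k bk' be & al * binom a bl + be * a k = 1].
    rewrite -(binomN a bl) /a1 -mutN; apply: (Wring_comaximal (bk := bk)) => //.
    + by rewrite mxE bll oppr0.
    + by rewrite mxE oppr_lt0.
  by apply: (Wring_saturated Wal Wbe (WP bk') _ Ws Wt); rewrite a1k.
- move: bk'0 Ws; rewrite -(binom_mut a bl bll) /bk' mutcol_id // => _ Ws.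
  exact: (Wring_coprime fa1 bkk y bk0 wk wl L1f Ws).
Qed.

End Adjacent.

(** The binomial is a unit times [X^b + 1]. Up to replacing [b] by [- b], some coordinate of [b] is
    positive and serves as the grading in [binom1X_dvd_bounded]. *)
Lemma binom_dvd_bounded (K : idomainType) (N : nat) (F : fieldType)
  (io : {rmorphism K -> F}) (a : 'I_N -> F) (b : 'rV[int]_N) f :
  free_family io a -> b != 0 -> f != 0 -> Lring io a f ->
  exists w, forall s, Lring io a (f / binom a b ^+ s) -> (s <= w)%N.
Proof.
move=> fa b0 f0 [h ef].
wlog [i bi] : b b0 / exists i, 0 < b 0 i.
  move=> wl; have /rV0Pn[i bi] := b0.
  have [lt|le|eq] := ltrgtP (b 0 i) 0; last by rewrite eq eqxx in bi.
    have [||w wP] := wl (- b); rewrite ?oppr_eq0 //.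
      by exists i; rewrite mxE oppr_gt0.
    by exists w => s; rewrite -(binomN a b); apply: wP.
  by apply: wl => //; exists i.
have a0 := free_neq0 fa; have h0 : h != 0.
  by apply: contraNneq f0 => eh; rewrite ef eh gev0.
have [|w wP] := @binom1X_dvd_bounded K 'rV[int]_N (pairing (delta_mx i 0)) b h _ h0.
  by rewrite /= pairing_delta.
exists w => s [e ee].
apply: (wP s (grmon K (posp (- b) *+ s) * e)); apply: (free_inj fa).
have e1 : gev io a (grmon K b + 1) = chi a b + 1.
  exact: etrans (gevD io a _ _) (congr2 +%R (gev_mon io a b) (gev1 io a)).
have eX : gev io a ((grmon K b + 1) ^+ s) = (chi a b + 1) ^+ s.
  exact: etrans (gevX io a0 _ s) (congr1 (fun x => x ^+ s) e1).
have eM v : gev io a (grmon K v * e) = chi a v * gev io a e.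
  exact: etrans (gevM io a0 _ _) (congr1 ( *%R^~ _) (gev_mon io a v)).
apply: etrans (esym (etrans (gevM io a0 _ _) (congr2 *%R eX (eM _)))).
rewrite -ee -ef (chiMn a0) mulrA -exprMn.
have -> : (chi a b + 1) * chi a (posp (- b)) = binom a b.
  by rewrite mulrDl mul1r -(chiD a0) -{1}(pospB b) subrK.
by rewrite mulrCA mulfV ?mulr1 // expf_neq0 // (binom_neq0 fa).
Qed.

(** * Frozen variables as additional Laurent variables over [K] *)

Section ExtendedCluster.
Variables (K : idomainType) (n m : nat) (F : fieldType).
Variable em : {rmorphism KP K m -> F}.
Local Notation G := 'rV[int]_(n + m).
Implicit Types (A : 'I_n -> F) (x z : 'rV[int]_m) (g : G).

Definition grconst (c : K) : KP K m := grcmon c (0 : 'rV[int]_m).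

Lemma grconst_additive : additive grconst.
Proof. exact: (monalg.monalgUB 0). Qed.

Lemma grconst_monoid : monoid_morphism grconst.
Proof.
split=> // c1 c2; rewrite /grconst -[RHS]/(grmul _ _).
by rewrite [RHS]grmulUU addr0.
Qed.

HB.instance Definition _ :=
  GRing.isAdditive.Build K (KP K m) grconst grconst_additive.
HB.instance Definition _ :=
  GRing.isMonoidMorphism.Build K (KP K m) grconst grconst_monoid.

Definition constF : {rmorphism K -> F} := em \o grconst.

Definition tropE x : F := em (grmon K x).

(** The extended cluster; treating the [Z_r] as variables reduces the coefficients from [KP] to
    [K]. *)
Definition extcl A (i : 'I_(n + m)) : F :=
  match split i with inl j => A j | inr r => tropE (delta_mx 0 r) end.

Lemma tropED x z : tropE (x + z) = tropE x * tropE z.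
Proof. by rewrite /tropE grmonD rmorphM. Qed.

Lemma tropE0 : tropE 0 = 1.
Proof. by rewrite /tropE grmon0 rmorph1. Qed.

Lemma tropE_neq0 x : tropE x != 0.
Proof.
apply/eqP => x0; have /eqP := tropED x (- x).
by rewrite subrr tropE0 x0 mul0r oner_eq0.
Qed.

Lemma tropEN x : tropE (- x) = (tropE x)^-1.
Proof.
apply: (mulfI (tropE_neq0 x)).
by rewrite -tropED subrr tropE0 mulfV // tropE_neq0.
Qed.

Lemma tropEMz x (c : int) : tropE (x *~ c) = tropE x ^ c.
Proof.
have posE s : tropE (x *+ s) = tropE x ^+ s.
  elim: s => [|s IHs]; first by rewrite mulr0n tropE0.
  by rewrite mulrS tropED IHs exprS.
case: c => s; first by rewrite -pmulrn posE.
by rewrite NegzE mulrNz -pmulrn tropEN posE exprnN.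
Qed.

Lemma tropE_prod x : \prod_r tropE (delta_mx 0 r) ^ x 0 r = tropE x.
Proof.
rewrite [in RHS](row_sum_delta x).
rewrite (big_morph tropE tropED tropE0).
apply: eq_bigr => r _; rewrite -tropEMz.
by rewrite -[in RHS](intz (x 0 r)) scaler_int.
Qed.

Lemma extcl_l A j : extcl A (lshift m j) = A j.
Proof. by rewrite /extcl (unsplitK (inl j)). Qed.

Lemma extcl_r A r : extcl A (rshift n r) = tropE (delta_mx 0 r).
Proof. by rewrite /extcl (unsplitK (inr r)). Qed.

Lemma chi_extcl A g :
  chi (extcl A) g = (\prod_j A j ^ g 0 (lshift m j)) * tropE (rsubmx g).
Proof.
rewrite /chi big_split_ord /=; congr (_ * _).
  by apply: eq_bigr => j _; rewrite extcl_l.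
by rewrite -tropE_prod; apply: eq_bigr => r _; rewrite extcl_r mxE.
Qed.

Lemma extcl_neq0 A : (forall j, A j != 0) -> forall i, extcl A i != 0.
Proof.
by move=> A0 i; rewrite /extcl; case: (split i) => [j|r]; rewrite ?A0 ?tropE_neq0.
Qed.

Lemma em_cmon c x : em (grcmon c x) = constF c * tropE x.
Proof.
rewrite /constF /tropE /= -rmorphM; congr (em _).
by rewrite -[RHS]/(grmul _ _) [RHS]grmulUU add0r mulr1.
Qed.

(* Cleared of the denominator [\prod_j A j ^+ M]; junk unless all exponents of
   [h] in the first [n] variables are at least [- M], because of [absz]. *)
Definition numer (M : nat) (h : groupring K G) : {mpoly (KP K m)[n]} :=
  \sum_(g <- grsupp h) (grcmon (grcoef g h) (rsubmx g) : KP K m)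
    *: 'X_[ [multinom absz (g 0 (lshift m j) + M%:Z)%R | j < n] ].

Lemma mmap_numer A M h : (forall j, A j != 0) ->
  (forall g j, grcoef g h != 0 -> 0 <= g 0 (lshift m j) + M%:Z) ->
  mmap em A (numer M h) = gev constF (extcl A) h * \prod_j A j ^+ M.
Proof.
move=> A0 hM; rewrite /numer raddf_sum {3}[h]grsum_cmon.
rewrite (big_morph (gev constF (extcl A)) (gevD _ _) (gev0 _ _)) mulr_suml.
apply: eq_bigr => g _; rewrite /= mmapZ /= em_cmon mmapX gev_cmon chi_extcl.
have [->|hg] := eqVneq (grcoef g h) 0; first by rewrite rmorph0 !mul0r.
rewrite -!mulrA; congr (_ * _); rewrite mulrCA; congr (_ * _).
rewrite /mmap1 -big_split; apply: eq_bigr => j _; rewrite mnmE /=.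
by rewrite exprnP gez0_abs ?hM // expfzDr.
Qed.

Lemma support_bounded (h : groupring K G) :
  exists M : nat, forall g j, grcoef g h != 0 -> 0 <= g 0 (lshift m j) + M%:Z.
Proof.
exists (\sum_(g <- grsupp h) \sum_(j < n) absz (g 0%R (lshift m j)))%N => g j.
rewrite -mem_grsupp => gh.
rewrite (bigD1_seq g) ?grsupp_uniq //= (bigD1 j) //=; move: (g 0 _) => x; lia.
Qed.

Lemma injective_neq0 A : injective (mmap em A) -> forall j, A j != 0.
Proof.
move=> inj j; apply/eqP => Aj0; have : mmap em A 'X_j = mmap em A 0.
  rewrite mmapX raddf0 /mmap1 (bigD1 j) //= mnmE eqxx expr1.
  by rewrite Aj0 mul0r.
move/inj/(congr1 (mcoeff U_(j)%MM)); rewrite mcoeffX eqxx mcoeff0 => /eqP.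
by rewrite oner_eq0.
Qed.

Lemma grcoef_sum (I : Type) (r : seq I) (E : I -> KP K m) z :
  grcoef z (\sum_(i <- r) E i) = \sum_(i <- r) grcoef z (E i).
Proof. exact: (big_morph (grcoef z) (grcoefD z) (grcoef0 _ z)). Qed.

(** The shifted exponents are nonnegative, so [absz] loses nothing: an exponent is recovered from
    its cluster part and its frozen part, and the terms of [numer M h] do not cancel. *)
Lemma numer_eq0 M h :
  (forall g j, grcoef g h != 0 -> 0 <= g 0 (lshift m j) + M%:Z) ->
  numer M h = 0 -> h = 0.
Proof.
move=> hM e; apply: grcoefP => g0; rewrite grcoef0; apply/eqP.
apply: contraT => hg0.
pose mu g := [multinom absz (g 0%R (lshift m j) + M%:Z)%R | j < n].
have termE g : grcoef (rsubmx g0) (mcoeff (mu g0)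
    ((grcmon (grcoef g h) (rsubmx g) : KP K m) *: 'X_[mu g]))
    = grcoef g h *+ ((mu g == mu g0) && (rsubmx g == rsubmx g0)).
  rewrite mcoeffZ mcoeffX; case: (mu g == mu g0); last by rewrite mulr0 grcoef0.
  by rewrite mulr1 grcoef_cmon.
have := congr1 (fun p => grcoef (rsubmx g0) (mcoeff (mu g0) p)) e.
rewrite /numer raddf_sum /= grcoef_sum mcoeff0 grcoef0.
rewrite (eq_bigr _ (fun g _ => termE g)).
have g0h : g0 \in grsupp h by rewrite mem_grsupp.
rewrite (bigD1_seq g0 g0h (grsupp_uniq h)).
rewrite (eqxx (mu g0)) (eqxx (rsubmx g0)) mulr1n big1_seq.
  by rewrite /= addr0 => /eqP; rewrite (negPf hg0).
move=> g /andP[gg0]; rewrite mem_grsupp => hg.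
case: (eqVneq (mu g) (mu g0)) => [emu|_]; last by rewrite mulr0n.
case: (eqVneq (rsubmx g) (rsubmx g0)) => [er|_]; last by rewrite mulr0n.
case/eqP: gg0; rewrite -[g]hsubmxK -[g0]hsubmxK er; congr row_mx.
apply/rowP => j; rewrite !mxE; have := congr1 (fun x : 'X_{1..n} => x j) emu.
rewrite !mnmE; have := hM _ j hg; have := hM _ j hg0.
by move: (g 0 _) (g0 0 _) => x y; lia.
Qed.

Lemma free_extcl A : injective (mmap em A) -> free_family constF (extcl A).
Proof.
move=> inj h e; have A0 := injective_neq0 inj; have [M hM] := support_bounded h.
apply: (numer_eq0 hM); apply: inj.
by rewrite mmap_numer // e mul0r raddf0.
Qed.

Lemma Lring_em A c : (forall j, A j != 0) -> Lring constF (extcl A) (em c).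
Proof.
move=> A0; have A'0 := extcl_neq0 A0; rewrite [c]grsum_cmon raddf_sum /=.
apply: big_ind => [||z _]; first exact: Lring0.
  by move=> x y; apply: LringD.
rewrite em_cmon; apply: LringM => //; first exact: Lring_const.
have -> : tropE z = chi (extcl A) (row_mx 0 z); last exact: Lring_chi.
rewrite chi_extcl row_mxKr big1 ?mul1r // => j _.
by rewrite row_mxEl mxE expr0z.
Qed.

Lemma Lring_mmap A a (p : {mpoly (KP K m)[n]}) : (forall i, a i != 0) ->
  (forall c, Lring constF a (em c)) -> (forall j, Lring constF a (A j)) ->
  @Lring K (n + m) F constF a (mmap em A p).
Proof.
move=> a0 Lem LA; rewrite [p]mpolyE raddf_sum /=.
apply: big_ind => [|x y|mu _]; [exact: Lring0 | exact: LringD |].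
rewrite mmapZ mmapX; apply: LringM => //.
have L1 : Lring constF a 1 by rewrite -(rmorph1 constF); apply: Lring_const.
apply: big_ind => // [x y|j _]; first exact: LringM.
elim: (mu j) => [|s IHs]; first exact: L1.
by rewrite exprS; apply: LringM.
Qed.

Lemma Lring_extcl A f : (forall j, A j != 0) ->
  Lring constF (extcl A) f <->
  exists (p : {mpoly (KP K m)[n]}) (d : 'cV[int]_n),
    f = mmap em A p / \prod_j A j ^ d j 0.
Proof.
move=> A0; have A'0 := extcl_neq0 A0; split=> [[h ->]|[p [d ->]]].
  have [M hM] := support_bounded h; exists (numer M h), (const_mx M%:Z).
  rewrite mmap_numer //; under [X in _ / X]eq_bigr => j _ do rewrite mxE.
  by rewrite mulfK //; apply/prodf_neq0 => j _; rewrite expf_neq0.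
apply: LringM => //.
  apply: Lring_mmap => // [c|j]; first exact: Lring_em.
  by have := Lring_var constF A'0 (lshift m j) 1; rewrite extcl_l expr1z.
have -> : (\prod_j A j ^ d j 0)^-1 = chi (extcl A) (row_mx (- d^T) 0).
  rewrite chi_extcl row_mxKr tropE0 mulr1 -prodfV; apply: eq_bigr => j _.
  by rewrite row_mxEl !mxE invr_expz.
exact: Lring_chi.
Qed.

End ExtendedCluster.

(** * Seeds in terms of extended clusters and extended exchange columns *)

Lemma prod_max0 (n : nat) (F : fieldType) (A : 'I_n -> F) (e : 'I_n -> int) :
  \prod_(j | 0 < e j) A j ^ e j = \prod_j A j ^ Num.max (e j) 0.
Proof.
rewrite big_mkcond; apply: eq_bigr => j _.
by case: ltrP => // _; rewrite expr0z.
Qed.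

(** Splits the mutation rule into a column operation and a row operation, for
    [ecol_free_mutation]. *)
Lemma sgr_max (x q : int) :
  Num.sg x * Num.max (x * q) 0 = Num.max q 0 * x + q * Num.max (- x) 0.
Proof. by case: (ltrgtP x 0) => [x0|x0|->]; case: (ltrgtP q 0) => [q0|q0|->]; nia. Qed.

Section Seeds.
Variables (K : idomainType) (n m : nat).
Implicit Types (S : seed K n m) (k l : 'I_n).

Local Notation emb := (@ambientC K n m : {rmorphism KP K m -> ambient K n m}).

Definition ecl S : 'I_(n + m) -> ambient K n m := extcl emb (clus S).

Definition ecol S k : 'rV[int]_(n + m) :=
  row_mx (\row_i exch S i k) (coef S k : 'rV[int]_m).

Definition laurent S : ambient K n m -> Prop := Lring (constF emb) (ecl S).

Lemma ecol_l S k i : ecol S k 0 (lshift m i) = exch S i k.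
Proof. by rewrite row_mxEl mxE. Qed.

Lemma ecol_r S k r : ecol S k 0 (rshift n r) = (coef S k : 'rV[int]_m) 0 r.
Proof. by rewrite row_mxEr. Qed.

Lemma ecl_free S : is_seed S -> free_family (constF emb) (ecl S).
Proof. by move=> [_ [inj _]]; apply: free_extcl. Qed.

Lemma clus_neq0 S : is_seed S -> forall j, clus S j != 0.
Proof. by move=> [_ [inj _]]; apply: injective_neq0 inj. Qed.

Lemma laurentP S f : is_seed S -> laurent_ring S f <-> laurent S f.
Proof.
by move=> /clus_neq0 A0; rewrite /laurent /ecl Lring_extcl.
Qed.

Lemma chi_ecl S g : chi (ecl S) g
  = tropF K n (rsubmx g) * \prod_j clus S j ^ g 0 (lshift m j).
Proof. exact: etrans (chi_extcl emb (clus S) g) (mulrC _ _). Qed.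

(** In the tropical semifield [X_k / (1 \oplus X_k)] keeps the positive exponents of [X_k], and
    [1 / (1 \oplus X_k)] those of its inverse. *)
Lemma exchange_binomialE S k : exchange_binomial S k = binom (ecl S) (ecol S k).
Proof.
have pE (g : 'rV[int]_(n + m)) r : rsubmx (posp g) 0 r = Num.max (g 0 (rshift n r)) 0.
  by rewrite !mxE.
have e1 : coef S k - oplus 0 (coef S k) = rsubmx (posp (ecol S k)).
  apply/rowP => r; rewrite pE ecol_r !mxE.
  by move: ((coef S k : 'rV[int]_m) 0 r) => x; lia.
have e2 : - oplus 0 (coef S k) = rsubmx (posp (- ecol S k)).
  apply/rowP => r; rewrite pE [(- _ : 'rV_(n + m)) 0 _]mxE ecol_r !mxE.
  by move: ((coef S k : 'rV[int]_m) 0 r) => x; lia.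
have e3 : \prod_(j | 0 < exch S j k) clus S j ^ exch S j k
    = \prod_j clus S j ^ posp (ecol S k) 0 (lshift m j).
  apply: etrans (prod_max0 _ _) _.
  by apply: eq_bigr => j _; rewrite mxE ecol_l.
have e4 : \prod_(j | exch S j k < 0) clus S j ^ (- exch S j k)
    = \prod_j clus S j ^ posp (- ecol S k) 0 (lshift m j).
  rewrite (eq_bigl (fun j => 0 < - exch S j k)); last first.
    by move=> j; rewrite oppr_gt0.
  apply: etrans (prod_max0 _ _) _.
  by apply: eq_bigr => j _; rewrite mxE [(- _ : 'rV_(_)) 0 _]mxE ecol_l.
rewrite /binom (chi_ecl S (posp (ecol S k))) (chi_ecl S (posp (- ecol S k))).
by rewrite -e1 -e2 -e3 -e4.
Qed.

Lemma ecl_mutation S k :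
  ecl (mutation k S) = mut (lshift m k) (ecol S k) (ecl S).
Proof.
apply/funext => i; rewrite /ecl /mut -/(ecl S) -exchange_binomialE.
case: S => B X A; rewrite /ecl; case: (split_ordP i) => [j|r] ->.
  by rewrite !extcl_l ffunE (inj_eq (@lshift_inj _ _)) mulrC; case: eqP => // ->.
by rewrite !extcl_r eq_rlshift.
Qed.

Lemma ecol_mutation S k l : k != l ->
  ecol (mutation l S) k = mutcol (lshift m l) (ecol S l) (ecol S k).
Proof.
move=> kl; apply/rowP => i; rewrite [RHS]mxE; case: (split_ordP i) => [j|r] ->.
  rewrite !ecol_l (inj_eq (@lshift_inj _ _)); case: S => B X A.
  by rewrite !mxE (negPf kl) orbF; case: eqP => [->|].
rewrite eq_rlshift !ecol_r ecol_l; case: S => B X A /=.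
rewrite ffunE (negPf kl) -!scaler_int !mxE !intz.
move: (B l k) (X l 0 r) (X k 0 r) => b x y.
by case: (ltrgtP x 0) => [x0|x0|->]; case: (ltrgtP b 0) => [b0|b0|->]; nia.
Qed.

Lemma ecol_mutation_same S k : ecol (mutation k S) k = - ecol S k.
Proof.
apply/rowP => i; rewrite [RHS]mxE; case: (split_ordP i) => [j|r] ->.
  by rewrite !ecol_l; case: S => B X A; rewrite !mxE eqxx orbT.
by rewrite !ecol_r; case: S => B X A /=; rewrite ffunE eqxx mxE.
Qed.

Lemma skew_entry S : is_seed S -> exists2 s : 'I_n -> int, forall i, 0 < s i
  & forall i j, s i * exch S i j = - (s j * exch S j i).
Proof.
move=> [[s [s0 e]] _]; exists (s 0) => // i j; have /matrixP/(_ j i) := e.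
by rewrite mul_diag_mx !mxE.
Qed.

Lemma ecol_diag S k : is_seed S -> ecol S k 0 (lshift m k) = 0.
Proof.
move=> /skew_entry[s s0 /(_ k k)]; rewrite ecol_l.
by move: (s k) (s0 k) (exch S k k) => x x0 y; nia.
Qed.

Lemma ecol_sign S k l : is_seed S ->
  sign_coherent (lshift m k) (lshift m l) (ecol S k) (ecol S l).
Proof.
move=> /skew_entry[s s0 /(_ k l)]; rewrite /sign_coherent !ecol_l.
move: (s k) (s l) (s0 k) (s0 l) (exch S k l) (exch S l k) => x y x0 y0 a b e.
by case: (ltrgtP b 0) => b0; [apply: Or32|apply: Or31|apply: Or33]; split=> //; nia.
Qed.

(** Full rank restated over the integers, so that it can be followed through mutations. *)
Definition ecol_free S : Prop := forall v : 'I_n -> int,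
  (forall i, \sum_j v j * ecol S j 0 i = 0) -> forall j, v j = 0.

Lemma full_rank_ecol_free S : full_rank S -> ecol_free S.
Proof.
move=> fr v ev j; pose E := map_mx (intr : int -> rat) (extended_exchange_matrix S).
have fE : row_free E^T by rewrite /row_free mxrank_tr fr.
have : (\row_j (v j)%:~R : 'rV[rat]_n) *m E^T == 0.
  apply/eqP/rowP => i; rewrite !mxE; apply: etrans (congr1 (intr : int -> rat) (ev i)).
  rewrite rmorph_sum.
  apply: eq_bigr => j' _; rewrite mxE rmorphM; congr (_ * _).
  rewrite mxE [LHS]mxE; congr (_%:~R).
  case: (split_ordP i) => [i'|r] ->; rewrite ?ecol_l ?ecol_r.
    by rewrite col_mxEu.
  by rewrite col_mxEd mxE.
rewrite mulmx_free_eq0 // => /eqP/rowP/(_ j); rewrite !mxE => /eqP.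
by rewrite intr_eq0 => /eqP.
Qed.

(** A relation among the new columns yields one among the old. Row [l] only changes sign, and the
    relation in that row makes the row operations drop out; the column operations alter the
    coefficient at [l] alone. *)
Lemma ecol_free_mutation S l : is_seed S -> ecol_free S -> ecol_free (mutation l S).
Proof.
move=> sS fS v ev; have bll : ecol S l 0 (lshift m l) = 0 := ecol_diag l sS.
pose b j := ecol S j 0 (lshift m l).
have rowl : \sum_(j | j != l) v j * b j = 0.
  have := ev (lshift m l); rewrite (bigD1 l) //= ecol_mutation_same mxE.
  rewrite bll oppr0 mulr0 add0r.
  move=> /eqP; rewrite -oppr_eq0 -sumrN => /eqP e; rewrite -[RHS]e.
  apply: eq_bigr => j jl.
  by rewrite ecol_mutation // mxE eqxx mulrN opprK.
pose c := \sum_(j | j != l) v j * Num.max (b j) 0.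
(* [c] collects the multiples of column [l] added to the other columns; [v l] changes sign because
   column [l] is negated. *)
pose v' j := if j == l then c - v l else v j.
have v'0 : forall j, v' j = 0.
  apply: fS => i; rewrite (bigD1 l) //= {1}/v' eqxx.
  have -> : \sum_(j | j != l) v' j * ecol S j 0 i
      = \sum_(j | j != l) v j * ecol S j 0 i.
    by apply: eq_bigr => j /negPf jl; rewrite /v' jl.
  have [->|il] := eqVneq i (lshift m l); first by rewrite bll mulr0 add0r rowl.
  have := ev i; rewrite (bigD1 l) //= ecol_mutation_same mxE.
  have -> : \sum_(j | j != l) v j * ecol (mutation l S) j 0 i
      = \sum_(j | j != l) v j * ecol S j 0 i + c * ecol S l 0 i
        + (\sum_(j | j != l) v j * b j) * Num.max (- ecol S l 0 i) 0.
    rewrite /c !mulr_suml -!big_split; apply: eq_bigr => j jl.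
    rewrite ecol_mutation // mxE (negPf il) -/(b j) /=.
    by rewrite sgr_max; ring.
  rewrite rowl mul0r addr0 => e; rewrite -[RHS]e; ring.
have vj j : j != l -> v j = 0 by move=> /negPf jl; rewrite -(v'0 j) /v' jl.
move=> j; have [->|/vj //] := eqVneq j l.
have := v'0 l; rewrite /v' eqxx /c big1 ?sub0r => [/eqP|i /vj->]; last by rewrite mul0r.
by rewrite oppr_eq0 => /eqP.
Qed.

Lemma ecol_neq0 S k : ecol_free S -> ecol S k != 0.
Proof.
move=> fS; apply/eqP => e; have v0 i : \sum_j (j == k)%:R * ecol S j 0 i = 0.
  by rewrite big1 // => j _; case: eqP => [->|_]; rewrite ?mul0r // e mxE mulr0.
by have /eqP := fS _ v0 k; rewrite eqxx oner_eq0.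
Qed.

(** The functional is the 2 by 2 minor with column [k] in two fixed rows [i] and [j]. If for [i]
    with a nonzero entry in column [k] all these minors vanished, the two columns would be
    dependent. *)
Lemma ecol_independent S k l : ecol_free S -> k != l ->
  exists w, pairing w (ecol S k) = 0 /\ pairing w (ecol S l) != 0.
Proof.
move=> fS kl; have /rV0Pn[i ki] := ecol_neq0 k fS.
have [j] : exists j, ecol S k 0 j * ecol S l 0 i - ecol S k 0 i * ecol S l 0 j != 0.
  apply: contrapT => no.
  pose v j := if j == k then ecol S l 0 i else if j == l then - ecol S k 0 i else 0.
  have v0 j : \sum_j' v j' * ecol S j' 0 j = 0.
    rewrite (bigD1 k) //= (bigD1 l) 1?eq_sym //= big1 => [|j' /andP[jk jl]]; last first.
      by rewrite /v (negPf jk) (negPf jl) mul0r.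
    rewrite addr0 /v !eqxx [l == k]eq_sym (negPf kl).
    apply/eqP; apply: contra_notT no => nz; exists j.
    by apply: contraNneq nz => z; rewrite mulrC mulNr z.
  have /eqP := fS v v0 l.
  by rewrite /v eqxx [l == k]eq_sym (negPf kl) oppr_eq0 (negPf ki).
move=> nz; exists (ecol S k 0 j *: delta_mx i 0 - ecol S k 0 i *: delta_mx j 0).
have pE (p q : int) (x : 'rV[int]_(n + m)) :
    pairing (p *: delta_mx i 0 - q *: delta_mx j 0) x = p * x 0 i - q * x 0 j.
  by rewrite /pairing !mulmxBr -!scalemxAr -!colE !mxE.
by rewrite !pE; split; [rewrite mulrC subrr|].
Qed.

(** This is [U0(t)], often called the upper bound of the seed. *)
Definition neighbourly S (f : ambient K n m) : Prop :=
  laurent S f /\ forall k, laurent (mutation k S) f.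

Lemma laurent_mutation S k f : laurent (mutation k S) f <->
  Lring (constF emb) (mut (lshift m k) (ecol S k) (ecl S)) f.
Proof. by rewrite /laurent (ecl_mutation S k). Qed.

(** The hypothesis on the double mutation settles the direction [k = l]; a seed pattern supplies it
    by reading an edge both ways. *)
Lemma neighbourly_mutation S l f :
  is_seed S -> ecol_free S -> is_seed (mutation l S) ->
  mutation l (mutation l S) = S ->
  neighbourly S f -> neighbourly (mutation l S) f.
Proof.
move=> sS fS sS1 inv [Lf Mf]; split=> [|k]; first exact: (Mf l).
have [->|kl] := eqVneq k l; first by rewrite inv; exact: Lf.
have fS1 := ecol_free_mutation (l := l) sS fS.
have Mk : Lring _ _ f := iffLR (laurent_mutation S k f) (Mf k).
have Ml : Lring _ _ f := iffLR (laurent_mutation S l f) (Mf l).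
have freeS := ecl_free sS; have freeS1 := ecl_free sS1.
have bk1 := ecol_neq0 k fS1.
apply: (iffRL (laurent_mutation (mutation l S) k f)).
rewrite (ecol_mutation S kl) in bk1 *; rewrite (ecl_mutation S l) in freeS1 *.
have klm : lshift m k != lshift m l by rewrite eq_lshift.
exact: (Lring_mut_mut freeS freeS1 klm (ecol_diag k sS) (ecol_diag l sS)
  (ecol_sign k l sS) (ecol_neq0 k fS) (ecol_neq0 l fS) bk1
  (ecol_independent fS kl) Lf Ml Mk).
Qed.

End Seeds.

(** * Connectedness of the regular tree *)

Section Tree.
Variable n : nat.

Lemma tree_neighbour (k : 'I_n) (t : tree n) : exists t', tree_edge k t t'.
Proof.
case: t => -[|j w] tw; first by exists (Sub [:: k] isT); left.
have [e|jk] := eqVneq k j.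
  by exists (Sub w (path_sorted tw)); right; rewrite /= e.
by exists (Sub [:: k, j & w] (introT andP (conj jk tw))); left.
Qed.

Lemma tree_edge_sym (k : 'I_n) t t' : tree_edge k t t' -> tree_edge k t' t.
Proof. by case; [right | left]. Qed.

(** Removing letters joins every vertex to the empty word, and edges can be followed both ways. *)
Lemma tree_connected (Q : tree n -> Prop) t t' :
  (forall k t t', tree_edge k t t' -> Q t -> Q t') -> Q t -> Q t'.
Proof.
move=> Qe; pose root : tree n := Sub [::] isT.
have down w tw : Q (Sub w tw) <-> Q root.
  elim: w tw => [|j w IHw] tw.
    by rewrite (_ : Sub _ _ = root) //; apply: val_inj.
  rewrite -(IHw (path_sorted tw)).
  by split; apply: (Qe j); [right | left].
case: t t' => [w tw] [w' tw'] Qt.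
exact: (iffRL (down w' tw') (iffLR (down w tw) Qt)).
Qed.

End Tree.

(** * The upper cluster algebra as [U0(t)] *)

Section Pattern.
Variables (K : idomainType) (n m : nat) (S : tree n -> seed K n m).
Hypothesis S_pattern : seed_pattern S.

Lemma pattern_seed t : is_seed (S t).
Proof. by case: S_pattern. Qed.

Lemma pattern_edge k t t' : tree_edge k t t' -> S t' = mutation k (S t).
Proof. by case: S_pattern => _; apply. Qed.

Lemma pattern_mutation t k : exists t', S t' = mutation k (S t).
Proof. by have [t' /pattern_edge] := tree_neighbour k t; exists t'. Qed.

(** Independence of the columns is carried along the tree together with membership, since every step
    uses it. *)
Theorem upper_cluster_algebra_neighbours t0 f : full_rank (S t0) ->
  upper_cluster_algebra S f <-> neighbourly (S t0) f.
Proof.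
move=> /full_rank_ecol_free fr; split=> [Uf|].
  split=> [|k]; first by apply/laurentP; [apply: pattern_seed | apply: Uf].
  have [t' e] := pattern_mutation t0 k; rewrite -e.
  by apply/laurentP; [apply: pattern_seed | apply: Uf].
move=> Nf t; apply/laurentP; first exact: pattern_seed.
suff [_ []//] : ecol_free (S t) /\ neighbourly (S t) f.
apply: (tree_connected (Q := fun t => ecol_free (S t) /\ neighbourly (S t) f))
  (conj fr Nf) => k t1 t2 e [fr1 N1].
have e21 := pattern_edge e; have e12 := pattern_edge (tree_edge_sym e).
have s1 := pattern_seed t1; have s2 := pattern_seed t2.
rewrite e21; split; first exact: ecol_free_mutation.
have s12 : is_seed (mutation k (S t1)) by rewrite -e21.
have inv : mutation k (mutation k (S t1)) = S t1 by rewrite -e21.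
exact: (neighbourly_mutation s1 fr1 s12 inv N1).
Qed.

End Pattern.

(** * Uniqueness of the d-vector *)

Section Presentation.
Variables (n : nat) (R : idomainType).
Implicit Types (P Q : {mpoly R[n]}) (u v : 'X_{1..n}).

Lemma mpoly_dvdX P j : (forall mu, mu \in msupp P -> (0 < mu j)%N) ->
  exists Q, P = 'X_j * Q.
Proof.
move=> Pj; exists (\sum_(mu <- msupp P) P@_mu *: 'X_[mu - U_(j)]).
rewrite {1}[P]mpolyE mulr_sumr !big_seq; apply: eq_bigr => mu /Pj muj.
rewrite -scalerAr -mpolyXD; congr (_ *: 'X_[_]); apply/mnmP => i.
rewrite mnmDE mnmBE mnm1E; case: eqP => [<-|_]; last by rewrite subn0.
by rewrite subnKC.
Qed.

Lemma mpolyX_dvdX P P' u v j : P * 'X_[u] = P' * 'X_[v] -> (v j < u j)%N ->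
  exists Q, P' = 'X_j * Q.
Proof.
move=> e vu; apply: mpoly_dvdX => mu; rewrite lt0n mcoeff_msupp => muP.
apply: contra_neq muP => muj; rewrite -(mcoeffMX P' v mu) -e.
apply/eqP; rewrite mcoeff_eq0 (perm_mem (msuppMX _ _)).
apply/mapP => -[nu _ /mnmP/(_ j)]; rewrite !mnmDE muj; lia.
Qed.

(** After clearing denominators, [d j 0 < d' j 0] would make ['X_j] divide [P']. Applied both ways,
    this gives uniqueness of the d-vector. *)
Lemma presentation_le (F : fieldType) (em : {rmorphism R -> F}) (A : 'I_n -> F)
    P P' (d d' : 'cV[int]_n) :
  injective (mmap em A) -> (forall j, A j != 0) ->
  (forall j, ~ exists Q, P' = 'X_j * Q) ->
  mmap em A P / \prod_j A j ^ d j 0 = mmap em A P' / \prod_j A j ^ d' j 0 ->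
  forall j, d' j 0 <= d j 0.
Proof.
move=> inj A0 nP' e j; rewrite leNgt; apply/negP => dd; apply: (nP' j).
(* [N] is large enough to make all shifted exponents nonnegative. *)
pose N := (\sum_i (absz (d i 0%R) + absz (d' i 0%R)))%N.
have Nd i : 0 <= d i 0 + N%:Z /\ 0 <= d' i 0 + N%:Z.
  by rewrite /N (bigD1 i) //=; move: (d i 0) (d' i 0) => x y; lia.
pose mon (c : 'cV[int]_n) := [multinom absz (c i 0%R + N%:Z)%R | i < n].
have monE (c : 'cV[int]_n) : (forall i, 0 <= c i 0 + N%:Z) ->
    mmap em A 'X_[mon c] = (\prod_i A i ^ c i 0) * \prod_(i < n) A i ^+ N.
  move=> c0; rewrite mmapX /mmap1 -big_split; apply: eq_bigr => i _.
  by rewrite mnmE exprnP gez0_abs ?c0 // expfzDr.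
have prod0 (c : 'cV[int]_n) : \prod_i A i ^ c i 0 != 0.
  exact: (prod_expz_neq0 (fun i => c i 0)).
apply: (@mpolyX_dvdX P P' (mon d') (mon d)); last first.
  by rewrite !mnmE; have [] := Nd j; move: (d j 0) (d' j 0) dd => x y; lia.
apply: inj; rewrite !rmorphM /= !monE => [||i]; try by case: (Nd i).
  by rewrite !mulrA; congr (_ * _); apply/eqP; rewrite -eqr_div ?e.
by move=> i; case: (Nd i).
Qed.

End Presentation.

(** * Valuations at an exchangeable variable *)

Section Valuation.
Variables (K : idomainType) (N n : nat) (F : fieldType) (io : {rmorphism K -> F}).
Variables (a : 'I_N -> F) (ix : 'I_n -> 'I_N) (b : 'I_n -> 'rV[int]_N).
Local Notation star k := (mut (ix k) (b k) a).
Hypotheses (ix_inj : injective ix) (free_a : free_family io a).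
Hypotheses (free_star : forall k, free_family io (star k)).
Hypotheses (b0 : forall k, b k != 0) (bk : forall k, b k 0 (ix k) = 0).

(** [U0] for an abstract family; [ix] picks out the exchangeable variables. *)
Definition upper (f : F) : Prop :=
  Lring io a f /\ forall k, Lring io (star k) f.

Definition val_at (k : 'I_n) (f : F) (s : nat) : Prop :=
  upper (f / a (ix k) ^+ s) /\
  forall r, upper (f / a (ix k) ^+ r) -> (r <= s)%N.

Let a0 := free_neq0 free_a.
Let star0 k := free_neq0 (@free_star k).

Lemma Lring_star_expz j k f (z : int) : j != k ->
  Lring io (star j) f -> Lring io (star j) (f * a (ix k) ^ z).
Proof.
move=> jk Lf; apply: LringM => //; have := Lring_var io (star0 j) (ix k) z.
by rewrite mut_ne // (inj_eq ix_inj) eq_sym.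
Qed.

Lemma star_mul_var k : a (ix k) * star k (ix k) = binom a (b k).
Proof. by rewrite mut_at mulrC divfK. Qed.

Lemma Lring_star_mul k f :
  Lring io (star k) f -> Lring io (star k) (f * a (ix k)).
Proof.
move=> Lf; have -> : a (ix k) = binom (star k) (b k) * star k (ix k) ^ (- 1).
  rewrite binom_mut ?bk // -star_mul_var exprN1 mulfK //; exact: star0.
apply: LringM => //; apply: LringM => //; first exact: Lring_binom.
exact: Lring_var.
Qed.

Lemma upper_mul k f : upper f -> upper (f * a (ix k)).
Proof.
move=> [Lf Mf]; split=> [|j].
  by apply: LringM => //; have := Lring_var io a0 (ix k) 1; rewrite expr1z.
have [->|jk] := eqVneq j k; first exact: Lring_star_mul.
by rewrite -[a _]expr1z; apply: Lring_star_expz.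
Qed.

Lemma upper_mulX k f s : upper f -> upper (f * a (ix k) ^+ s).
Proof.
move=> Uf; elim: s => [|s IHs]; first by rewrite mulr1.
by rewrite exprSr mulrA; apply: upper_mul.
Qed.

(** [a (ix k)] is a unit in all the Laurent rings involved but that of the mutation at [k]. *)
Lemma upper_expz k f (z : int) : upper f ->
  upper (f * a (ix k) ^ z) <-> Lring io (star k) (f * a (ix k) ^ z).
Proof.
move=> [Lf Mf]; split=> [[_]//|Lz]; split=> [|j].
  by apply: LringM => //; apply: Lring_var.
by have [->//|jk] := eqVneq j k; apply: Lring_star_expz.
Qed.

(** In the family mutated at [k], dividing by [a (ix k)] amounts to dividing by the binomial, up to
    the unit [star k (ix k)]. *)
Lemma star_div_bounded k f : f != 0 -> Lring io (star k) f ->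
  exists w, forall s, Lring io (star k) (f / a (ix k) ^+ s) -> (s <= w)%N.
Proof.
move=> f0 Lf; have [w wP] := binom_dvd_bounded (@free_star k) (b0 k) f0 Lf.
exists w => s Ls; apply: wP; rewrite binom_mut ?bk // -star_mul_var.
have -> : f / (a (ix k) * star k (ix k)) ^+ s
    = f / a (ix k) ^+ s * star k (ix k) ^ (- s%:Z).
  by rewrite -exprnN exprMn invfM mulrA.
by apply: LringM => //; apply: Lring_var.
Qed.

Lemma val_at_eq0 k f : upper f -> val_at k f 0 <-> ~ upper (f / a (ix k)).
Proof.
move=> Uf; split=> [[_ max0] U1|nU].
  by have := max0 1%N; rewrite expr1 => /(_ U1).
split=> [|[//|r] Ur]; first by rewrite divr1.
case: nU; have := upper_mulX k r Ur.
rewrite exprS invfM -!mulrA [X in _ * (_ * X)]mulVf ?mulr1 //.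
by rewrite expf_neq0.
Qed.

(** Both valuations are read off the largest [v] with [Z v]: the factor [a (ix k) ^ d k] of [p]
    shifts the exponent by [d k], and the other factors are units in the family mutated at [k]. *)
Lemma val_at_numerator f (d : 'I_n -> int) k (p := f * \prod_j a (ix j) ^ d j) :
  f != 0 -> upper f -> upper p ->
  exists vp vf, [/\ val_at k p vp, val_at k f vf & d k = vp%:Z - vf%:Z].
Proof.
(* [Z] is defined on all integers because the shift by [d k] can lead to negative exponents. *)
move=> f0 Uf Up; pose Z (z : int) := Lring io (star k) (f * a (ix k) ^ (- z)).
have Zf (s : nat) : upper (f / a (ix k) ^+ s) <-> Z s%:Z.
  by rewrite exprnN; apply: upper_expz.
have unit_part : exists u, [/\ u != 0, Lring io (star k) u, Lring io (star k) u^-1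
    & p = f * a (ix k) ^ d k * u].
  exists (\prod_(j | j != k) a (ix j) ^ d j).
  have L1 : Lring io (star k) 1.
    by have := Lring_const io (star k) 1; rewrite rmorph1.
  split.
  - by apply/prodf_neq0 => j _; rewrite expfz_neq0.
  - apply: (big_ind (Lring io (star k))) => // [x y|j jk]; first exact: LringM.
    by rewrite -[X in Lring _ _ X]mul1r; apply: Lring_star_expz; rewrite // eq_sym.
  - rewrite -prodfV; apply: (big_ind (Lring io (star k))) => // [x y|j jk].
      exact: LringM.
    rewrite invr_expz -[X in Lring _ _ X]mul1r.
    by apply: Lring_star_expz; rewrite // eq_sym.
  - by rewrite /p (bigD1 k) //= mulrA.
have Zp (s : nat) : upper (p / a (ix k) ^+ s) <-> Z (s%:Z - d k).
  rewrite exprnN upper_expz // /Z; have [u [u0 Lu LVu ->]] := unit_part.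
  have -> : f * a (ix k) ^ d k * u * a (ix k) ^ (- s%:Z)
      = f * a (ix k) ^ (- (s%:Z - d k)) * u.
    by rewrite opprB expfzDr // [LHS]mulrAC mulrA.
  split=> L; last exact: LringM.
  by rewrite -[X in Lring _ _ X](mulfK u0); apply: LringM.
have Z0 : Z 0 by rewrite /Z oppr0 expr0z mulr1; case: Uf.
(* Since [p] itself is in the ring, [v + d k] will be nonnegative, so the [absz] in the witness is
   harmless. *)
have Zd : Z (- d k).
  by rewrite -(sub0r (d k)); apply: (iffLR (Zp 0%N)); rewrite divr1.
have Zdown z (s : nat) : Z z -> Z (z - s%:Z).
  elim: s => [|s IHs] Zz; first by rewrite subr0.
  have -> : z - s.+1%:Z = z - s%:Z - 1 by lia.
  have := Lring_star_mul (IHs Zz); rewrite -mulrA -[X in _ * (_ * X)]expr1z.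
  by rewrite -expfzDr // /Z; congr (Lring _ _ (_ * _ ^ _)); lia.
have [w wP] : exists w, forall s : nat, Z s%:Z -> (s <= w)%N.
  have [w wP] := star_div_bounded f0 (proj2 Uf k).
  by exists w => s; rewrite /Z -exprnN; apply: wP.
have exZ : exists s : nat, `[< Z s%:Z >] by exists 0%N; apply/asboolP.
have bZ (s : nat) : `[< Z s%:Z >] -> (s <= w)%N by move=> /asboolP/wP.
have [v /asboolP Zv vmax] := ex_maxnP exZ bZ.
have vle z : Z z -> z <= v%:Z.
  by case: z => [s Zs|s _]; [rewrite lez_nat; apply/vmax/asboolP | ].
have dv : - d k <= v%:Z := vle _ Zd.
exists (absz (v%:Z + d k)), v; split.
- split=> [|r /Zp/vle]; last by lia.
  apply/Zp; have -> : (absz (v%:Z + d k))%:Z - d k = v%:Z by lia.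
  by [].
- by split=> [|r /Zf/vle]; [apply/Zf | rewrite lez_nat].
- lia.
Qed.

End Valuation.

(** * Pairings and d-vectors for the seed pattern *)

Section Pairing.
Variables (K : idomainType) (n m : nat) (S : tree n -> seed K n m).
Hypothesis S_pattern : seed_pattern S.
Variable t0 : tree n.
Hypothesis S_full_rank : full_rank (S t0).

Local Notation emb := (@ambientC K n m : {rmorphism KP K m -> ambient K n m}).
Local Notation A := (clus (S t0)).

(** A maximum is unique, so the choice made in [valuation_pairing] does not matter. *)
Lemma valuation_pairingP a f v :
  valuation_pairing S a f = Some v <-> is_valuation S a f v.
Proof.
have uniq s s' : is_valuation S a f s -> is_valuation S a f s' -> s = s'.
  by move=> [Us ms] [Us' ms']; apply/eqP; rewrite eqn_leq ms' // ms.
rewrite /valuation_pairing; case: pselect => [e|ne]; last first.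
  by split=> // vP; case: ne; exists v.
case: cid => s sP /=; split=> [[<-] //|vP].
by rewrite (uniq _ _ sP vP).
Qed.

Lemma d_vector_presentation f d P :
  d_presentation (S t0) f d P -> d_vector (S t0) f = d.
Proof.
move=> [nP fE]; rewrite /d_vector; case: pselect => [e|[]]; last by exists d, P.
case: cid => d' [P' [nP' fE']] /=.
have A0 := clus_neq0 (pattern_seed S_pattern t0).
have inj : injective (mmap emb A) by have [_ []] := pattern_seed S_pattern t0.
have e1 := etrans (esym fE) fE'.
apply/colP => j; apply/eqP; rewrite eq_le.
by rewrite (presentation_le inj A0 nP' e1) (presentation_le inj A0 nP (esym e1)).
Qed.

Let fr := full_rank_ecol_free S_full_rank.
Let seed0 := pattern_seed S_pattern t0.

Local Notation upper0 :=
  (upper (constF emb) (ecl (S t0)) (@lshift n m) (ecol (S t0))).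

Let b0 k : ecol (S t0) k != 0. Proof. exact: ecol_neq0 k fr. Qed.

Let bk k : ecol (S t0) k 0 (lshift m k) = 0.
Proof. exact: ecol_diag k seed0. Qed.

Let free0 : free_family (constF emb) (ecl (S t0)).
Proof. exact: ecl_free seed0. Qed.

Let free_star k : free_family (constF emb)
  (mut (lshift m k) (ecol (S t0) k) (ecl (S t0))).
Proof.
have [t' e] := pattern_mutation S_pattern t0 k.
have := ecl_free (pattern_seed S_pattern t').
by rewrite e (ecl_mutation (S t0) k).
Qed.

Lemma upper_cluster_algebraP f : upper_cluster_algebra S f <-> upper0 f.
Proof.
apply: (iff_trans (upper_cluster_algebra_neighbours S_pattern f S_full_rank)).
split=> -[Lf Mf]; (split; first exact: Lf) => k.
  exact: (iffLR (laurent_mutation (S t0) k f) (Mf k)).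
exact: (iffRL (laurent_mutation (S t0) k f) (Mf k)).
Qed.

Lemma is_valuationP k f s : is_valuation S (A k) f s <->
  val_at (constF emb) (ecl (S t0)) (@lshift n m) (ecol (S t0)) k f s.
Proof.
have eA : ecl (S t0) (lshift m k) = A k := extcl_l emb A k.
split=> -[Us ms]; split=> [|r Ur].
- by rewrite eA; apply: (iffLR (upper_cluster_algebraP _)).
- by apply: ms; apply: (iffRL (upper_cluster_algebraP _)); rewrite -eA.
- by apply: (iffRL (upper_cluster_algebraP _)); rewrite -eA.
- by apply: ms; rewrite eA; apply: (iffLR (upper_cluster_algebraP _)).
Qed.

Lemma upper0_eval (p : {mpoly (KP K m)[n]}) : upper0 (eval_at A p).
Proof.
have eA k : ecl (S t0) (lshift m k) = A k := extcl_l emb A k.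
have a0 := free_neq0 free0.
have emL c t : Lring (constF emb) (ecl (S t)) (emb c).
  exact: (Lring_em emb c (clus_neq0 (pattern_seed S_pattern t))).
have emU c : upper0 (emb c).
  split=> [|k]; first exact: emL.
  apply: (iffLR (laurent_mutation (S t0) k _)).
  by have [t' <-] := pattern_mutation S_pattern t0 k; apply: emL.
have AU j : upper0 (A j).
  have := upper_mul (@lshift_inj n m) free0 free_star bk j (emU 1).
  by rewrite eA rmorph1 mul1r.
split=> [|k]; apply: Lring_mmap => [|c|j].
- exact: a0.
- exact: (proj1 (emU c)).
- exact: (proj1 (AU j)).
- exact: (free_neq0 (@free_star k)).
- exact: (proj2 (emU c) k).
- exact: (proj2 (AU j) k).
Qed.

(** Multiplying [f] by all the [A j ^ d j 0] gives its numerator, so [val_at_numerator] applies. *)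
Lemma valuation_numerator f d P k : f != 0 -> upper_cluster_algebra S f ->
  d_presentation (S t0) f d P ->
  exists vP vf : nat, [/\ valuation_pairing S (A k) (eval_at A P) = Some vP,
    valuation_pairing S (A k) f = Some vf & d k 0 = vP%:Z - vf%:Z].
Proof.
move=> f0 Uf [_ fE]; have A0 := clus_neq0 seed0.
have eA j : ecl (S t0) (lshift m j) = A j := extcl_l emb A j.
have pE : f * \prod_j ecl (S t0) (lshift m j) ^ d j 0 = eval_at A P.
  rewrite (eq_bigr (fun j => A j ^ d j 0)); last first.
    by move=> j _; rewrite eA.
  by rewrite fE; exact: (divfK (prod_expz_neq0 (fun j => d j 0) A0)).
have Up := upper0_eval P; rewrite -pE in Up.
have [vp [vf [vpP vfP dE]]] := val_at_numerator (@lshift_inj n m) free0 free_star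
  b0 bk k f0 (iffLR (upper_cluster_algebraP f) Uf) Up.
exists vp, vf; split; last exact: dE.
  by apply/valuation_pairingP/is_valuationP; rewrite -pE.
by apply/valuation_pairingP/is_valuationP.
Qed.

Lemma valuation_pairing_eq0 f k : upper_cluster_algebra S f ->
  valuation_pairing S (A k) f = Some 0%N <-> ~ upper_cluster_algebra S (f / A k).
Proof.
move=> /upper_cluster_algebraP Uf.
apply: iff_trans (valuation_pairingP _ _ _) _; apply: iff_trans (is_valuationP _ _ _) _.
apply: iff_trans (val_at_eq0 (@lshift_inj n m) free0 free_star bk k Uf) _.
have eA : ecl (S t0) (lshift m k) = A k := extcl_l emb A k.
by rewrite eA; split=> nU /upper_cluster_algebraP.
Qed.

End Pairing.

Theorem theorem5p1 (K : idomainType) (n m : nat)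
  (K_factorial : factorial_domain K)
  (K_char0 : [pchar K] =i pred0)
  (S : tree n -> seed K n m)
  (S_pattern : seed_pattern S)
  (S_noninvertible : noninvertible_binomials S)
  (t0 : tree n)
  (S_full_rank : full_rank (S t0))
  (M : ambient K n m)
  (M_neq0 : M != 0)
  (M_upper : upper_cluster_algebra S M)
  (d : 'cV[int]_n) (P : {mpoly (KP K m)[n]})
  (M_presentation : d_presentation (S t0) M d P) :
  let A := clus (S t0) in
  let PM := eval_at A P in
  [/\ forall k : 'I_n,
        d k 0 = d_compatibility (S t0) k M /\
        exists vP vM : nat,
          [/\ valuation_pairing S (A k) PM = Some vP,
              valuation_pairing S (A k) M = Some vM
            & d k 0 = vP%:Z - vM%:Z],
      forall k : 'I_n,
        (valuation_pairing S (A k) M = Some 0%N <->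
           ~ upper_cluster_algebra S (M / A k)) /\
        (valuation_pairing S (A k) M = Some 0%N ->
           d k 0 = d_compatibility (S t0) k M /\
           exists vP : nat,
             [/\ valuation_pairing S (A k) PM = Some vP,
                 d k 0 = vP%:Z
               & 0 <= d k 0])
    & forall (M' : ambient K n m) (d' : 'cV[int]_n),
        M' != 0 -> upper_cluster_algebra S M' ->
        d_presentation (S t0) M' d' P ->
        (forall k, valuation_pairing S (A k) M = Some 0%N) ->
        (forall k, valuation_pairing S (A k) M' = Some 0%N) ->
        d' = d].
Proof.
move=> A PM.
have val f d1 Q := @valuation_numerator K n m S S_pattern t0 S_full_rank f d1 Q.
have dvec k : d k 0 = d_compatibility (S t0) k M.
  by rewrite /d_compatibility (d_vector_presentation S_pattern M_presentation).
split=> [k|k|M' d' M'_neq0 M'_upper M'_presentation v0 v0'].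
- by split; [exact: dvec | exact: val M_presentation].
- split; first exact: (valuation_pairing_eq0 S_pattern S_full_rank k M_upper).
  move=> v0; split; first exact: dvec.
  have [vP [vM [eP eM dE]]] := val _ _ _ k M_neq0 M_upper M_presentation.
  move: eM; rewrite v0 => -[vM0]; exists vP; split; first exact: eP.
    by rewrite dE -vM0 subr0.
  by rewrite dE -vM0 subr0.
(* Both entries equal the valuation of the common numerator. *)
- apply/colP => k.
  have [vP [vM [eP eM ->]]] := val _ _ _ k M_neq0 M_upper M_presentation.
  have [vP' [vM' [eP' eM' ->]]] := val _ _ _ k M'_neq0 M'_upper M'_presentation.
  move: eM eM' eP'; rewrite v0 v0' eP => -[<-] [<-] [->].
  by [].
Qed.
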